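(* Let $N\geqslant 2$ be an integer. The set of non-empty compact sets $M\subset\mathbb R^N$ that are in general position with respect to all projections is a dense $G_\delta$ subset of $\mathcal K(\mathbb R^N)$. Moreover, the set of non-empty compact sets $M\subset\ell_2$ that are in general position with respect to all projections with finite-dimensional kernels is a dense $G_\delta$ subset of $\mathcal K(\ell_2)$.
   Context: For a complete metric space $X$, $\mathcal K(X)$ denotes the space of all non-empty compact subsets of $X$ with the Hausdorff metric. $\ell_2$ is the separable real Hilbert space. Let $X$ be $\mathbb R^N$ or $\ell_2$. For a non-zero proper linear subspace $H$ of $X$, let $p_H: X\to H^\perp$ be the orthogonal projection onto $H^\perp$. For a non-empty $M\subset X$ and $A\in M$, let $F(A)=(p_H|_M)^{-1}(p_H(A))$ be the fiber through $A$; it is non-degenerate if $|F(A)|>1$. With $k=\dim H$, $M$ is in general position with respect to $H$ if: $p_H|_M$ has only finitely many non-degenerate fibers; each non-degenerate fiber $F(A)$ consists of at most $k+1$ points which are the vertices of a simplex of dimension $|F(A)|-1$ (i.e. they are affinely independent); and $\sum_{A\in M}(|F(A)|-1)\leqslant k$ (the sum over distinct fibers). $M$ is in general position with respect to all projections if this holds for every non-zero proper linear subspace $H$ of $X$; $M\subset\ell_2$ is in general position with respect to all projections with finite-dimensional kernels if this holds for every non-zero finite-dimensional linear subspace $H$ of $\ell_2$. *)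

(* Defs.v *)
From Stdlib Require Import Reals List ClassicalEpsilon.
From Coquelicot Require Import Coquelicot.
Open Scope R_scope.

(** Vectors: real sequences nat -> R.  R^N is modelled as the sequences
    supported on {0,...,N-1}; l_2 as the square-summable sequences. *)
Definition vec := nat -> R.
Definition vzero : vec := fun _ => 0.
Definition vadd (x y : vec) : vec := fun i => x i + y i.
Definition vscal (c : R) (x : vec) : vec := fun i => c * x i.
Definition vsub (x y : vec) : vec := fun i => x i - y i.

Definition ip (x y : vec) : R := Series (fun i => x i * y i).
Definition vnorm (x : vec) : R := sqrt (ip x x).
Definition vdist (x y : vec) : R := vnorm (vsub x y).

Definition RN (N : nat) (x : vec) : Prop := forall i, (N <= i)%nat -> x i = 0.
Definition l2 (x : vec) : Prop := ex_series (fun i => x i ^ 2).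

Definition lincomb (cs : list R) (vs : list vec) : vec :=
  fold_right (fun (p : R * vec) acc => vadd (vscal (Datatypes.fst p) (Datatypes.snd p)) acc) vzero (List.combine cs vs).
Definition lin_indep (vs : list vec) : Prop :=
  forall cs, length cs = length vs -> lincomb cs vs = vzero -> List.Forall (fun c => c = 0) cs.
Definition aff_indep (vs : list vec) : Prop :=
  forall cs, length cs = length vs -> fold_right Rplus 0 cs = 0 ->
    lincomb cs vs = vzero -> List.Forall (fun c => c = 0) cs.

Definition lin_subspace (S H : vec -> Prop) : Prop :=
  (forall x, H x -> S x) /\ H vzero /\
  (forall x y, H x -> H y -> H (vadd x y)) /\
  (forall c x, H x -> H (vscal c x)).
Definition nonzero_sub (H : vec -> Prop) : Prop := exists h, H h /\ h <> vzero.
Definition proper_sub (S H : vec -> Prop) : Prop := exists x, S x /\ ~ H x.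
Definition has_dim (H : vec -> Prop) (k : nat) : Prop :=
  exists b : list vec, length b = k /\ lin_indep b /\
    forall h, H h <-> exists cs, length cs = k /\ h = lincomb cs b.

Definition perp (S H : vec -> Prop) (y : vec) : Prop :=
  S y /\ forall h, H h -> ip y h = 0.
Definition projp (S H : vec -> Prop) (x : vec) : vec :=
  epsilon (inhabits vzero) (fun y => perp S H y /\ H (vsub x y)).

Definition fiber (S H M : vec -> Prop) (A : vec) : vec -> Prop :=
  fun B => M B /\ projp S H B = projp S H A.
Definition nondeg (S H M : vec -> Prop) (A : vec) : Prop :=
  exists B, fiber S H M A B /\ B <> A.
Definition enumerates (P : vec -> Prop) (l : list vec) : Prop :=
  NoDup l /\ forall x, In x l <-> P x.

(** General position of M with respect to H, where k = dim H. *)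
Definition gen_pos (S H : vec -> Prop) (k : nat) (M : vec -> Prop) : Prop :=
  (exists reps : list vec, List.Forall M reps /\
     forall A, M A -> nondeg S H M A ->
       exists a, In a reps /\ projp S H A = projp S H a) /\
  (forall A, M A -> nondeg S H M A ->
     exists l, enumerates (fiber S H M A) l /\ (length l <= k + 1)%nat /\ aff_indep l) /\
  (forall reps : list (vec * list vec),
     (forall p, In p reps -> M (fst p) /\ enumerates (fiber S H M (fst p)) (snd p)) ->
     ForallOrdPairs (fun p q => projp S H (fst p) <> projp S H (fst q)) reps ->
     (fold_right (fun p acc => (length (snd p) - 1) + acc) 0 reps <= k)%nat).

(** General position w.r.t. all projections (all non-zero proper subspaces;
    in R^N every subspace has some finite dimension k). *)
Definition gp_all_proj (S M : vec -> Prop) : Prop :=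
  forall H k, lin_subspace S H -> nonzero_sub H -> proper_sub S H -> has_dim H k ->
    gen_pos S H k M.
Definition gp_fd_proj (S M : vec -> Prop) : Prop :=
  forall H k, lin_subspace S H -> nonzero_sub H -> has_dim H k -> gen_pos S H k M.

Definition open_in (S U : vec -> Prop) : Prop :=
  (forall x, U x -> S x) /\
  forall x, U x -> exists e, 0 < e /\ forall y, S y -> vdist x y < e -> U y.
Definition compact_in (S M : vec -> Prop) : Prop :=
  (forall x, M x -> S x) /\
  forall (I : Type) (U : I -> vec -> Prop),
    (forall i, open_in S (U i)) -> (forall x, M x -> exists i, U i x) ->
    exists l : list I, forall x, M x -> exists i, In i l /\ U i x.
Definition Kset (S M : vec -> Prop) : Prop := compact_in S M /\ exists x, M x.

Definition pt_set_dist (a : vec) (B : vec -> Prop) : R :=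
  real (Glb_Rbar (fun r => exists b, B b /\ r = vdist a b)).
Definition excess (A B : vec -> Prop) : R :=
  real (Lub_Rbar (fun r => exists a, A a /\ r = pt_set_dist a B)).
Definition hdist (A B : vec -> Prop) : R := Rmax (excess A B) (excess B A).

Definition K_open (S : vec -> Prop) (U : (vec -> Prop) -> Prop) : Prop :=
  (forall M, U M -> Kset S M) /\
  forall M, U M -> exists e, 0 < e /\ forall M', Kset S M' -> hdist M M' < e -> U M'.
Definition K_dense (S : vec -> Prop) (D : (vec -> Prop) -> Prop) : Prop :=
  forall M, Kset S M -> forall e, 0 < e -> exists M', Kset S M' /\ D M' /\ hdist M M' < e.
Definition K_Gdelta (S : vec -> Prop) (D : (vec -> Prop) -> Prop) : Prop :=
  exists U : nat -> (vec -> Prop) -> Prop,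
    (forall n, K_open S (U n)) /\ forall M, D M <-> forall n, U n M.
Definition K_dense_Gdelta (S : vec -> Prop) (D : (vec -> Prop) -> Prop) : Prop :=
  (forall M, D M -> Kset S M) /\ K_dense S D /\ K_Gdelta S D.

(* Main.v *)
Require Import Defs.
From Stdlib Require Import Reals Lra Lia.
From Stdlib Require Import Classical ClassicalEpsilon FunctionalExtensionality PropExtensionality.
From Stdlib Require Cantor.
From Coquelicot Require Import Coquelicot.
From Stdlib Require Import List.
Import ListNotations.
Open Scope R_scope.

(** Call a finite list of pairs (A_i, B_i) a star list if the A_i are pairwise distinct and no A_i
    is a B_j, and say that m is admissible if m <= N (no condition in l_2).  A set M is in general
    position if and only if every star list of admissible length in M has linearly independent
    differences A_i - B_i.  Indeed, choosing a centre B in each fiber and pairing the other points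
    with it gives a star list whose differences lie in H, so its length is at most dim H when they
    are independent; conversely, the span of dependent differences is a kernel H for which the
    fibers are too large.

    For fixed length and fixed separation of the points, independence of the differences is an open
    condition on M by compactness, which gives a G_delta set.  It is dense because M is close to a
    finite set p_0, ..., p_(n-1), on which there are only finitely many patterns of indices: each
    pattern can be made independent by moving the leaves A_i one after the other out of the span of
    the previous differences, and small enough moves preserve the patterns already treated. *)

Ltac vec_eq :=
  apply functional_extensionality; intro;
  unfold vadd, vscal, vsub, vzero in *; try ring.

(** * The Hilbert space l_2 *)

Lemma l2_mul (x y : vec) : l2 x -> l2 y -> ex_series (fun i => x i * y i).
Proof.
  intros Hx Hy.
  apply (ex_series_le (V := R_CompleteNormedModule) _ (fun i => x i ^ 2 + y i ^ 2)).
  - intro n. change (Rabs (x n * y n) <= x n ^ 2 + y n ^ 2).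
    apply Rabs_le. split; nra.
  - exact (ex_series_plus _ _ Hx Hy).
Qed.

Lemma l2_add (x y : vec) : l2 x -> l2 y -> l2 (vadd x y).
Proof.
  intros Hx Hy.
  apply (ex_series_le (V := R_CompleteNormedModule) _ (fun i => 2 * x i ^ 2 + 2 * y i ^ 2)).
  - intro n. change (Rabs ((x n + y n) ^ 2) <= 2 * x n ^ 2 + 2 * y n ^ 2).
    rewrite Rabs_pos_eq by apply pow2_ge_0. generalize (pow2_ge_0 (x n - y n)). nra.
  - apply (ex_series_plus (fun i => 2 * x i ^ 2) (fun i => 2 * y i ^ 2));
      apply (ex_series_scal_l (V := R_NormedModule) 2); assumption.
Qed.

Lemma l2_scal (c : R) (x : vec) : l2 x -> l2 (vscal c x).
Proof.
  intros Hx.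
  apply (ex_series_ext (fun i => c ^ 2 * x i ^ 2)).
  - intro n. unfold vscal. simpl. ring.
  - apply (ex_series_scal_l (V := R_NormedModule) (c ^ 2)); assumption.
Qed.

Lemma RN_l2 (N : nat) (x : vec) : RN N x -> l2 x.
Proof.
  intros Hx. apply (ex_series_incr_n _ N). exists 0.
  apply (is_series_ext (fun _ => 0)).
  - intro n. rewrite Hx by lia. simpl. ring.
  - apply (filterlim_ext (fun _ => 0)).
    + intro n. symmetry. rewrite sum_n_const. ring.
    + apply filterlim_const.
Qed.

Lemma l2_zero : l2 vzero.
Proof. apply (RN_l2 0). intros i _. reflexivity. Qed.

Lemma vsub_eq (x y : vec) : vsub x y = vadd x (vscal (-1) y).
Proof. vec_eq. Qed.

Lemma ip_comm (x y : vec) : ip x y = ip y x.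
Proof. apply Series_ext. intro n. ring. Qed.

Lemma ip_add_l (x y z : vec) : l2 x -> l2 y -> l2 z -> ip (vadd x y) z = ip x z + ip y z.
Proof.
  intros Hx Hy Hz. unfold ip.
  rewrite <- Series_plus by (apply l2_mul; assumption).
  apply Series_ext. intro n. unfold vadd. ring.
Qed.

Lemma ip_scal_l (c : R) (x z : vec) : ip (vscal c x) z = c * ip x z.
Proof.
  unfold ip. rewrite <- Series_scal_l. apply Series_ext. intro n. unfold vscal. ring.
Qed.

(** The partial sums of the non-negative series [ip x x] increase to its value, and the sum up to
    [i] contains the term [x i ^ 2]. Definiteness of the inner product follows. *)
Lemma ip_self_ge (x : vec) (i : nat) : l2 x -> x i ^ 2 <= ip x x.
Proof.
  intros Hx.
  assert (Hs : ex_series (fun n => x n * x n)) by (apply l2_mul; assumption).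
  assert (Hc : sum_n (fun n => x n * x n) i <= ip x x).
  { apply (is_lim_seq_incr_compare (sum_n (fun n => x n * x n))).
    - exact (Series_correct _ Hs).
    - intro n. rewrite sum_Sn. change (sum_n (fun n => x n * x n) n <=
        sum_n (fun n => x n * x n) n + x (S n) * x (S n)). nra. }
  apply Rle_trans with (2 := Hc).
  assert (Hp : forall j, 0 <= sum_n (fun n => x n * x n) j).
  { induction j.
    - rewrite sum_O. nra.
    - rewrite sum_Sn. change (0 <= sum_n (fun n => x n * x n) j + x (S j) * x (S j)). nra. }
  destruct i.
  - rewrite sum_O. nra.
  - rewrite sum_Sn. change (x (S i) ^ 2 <= sum_n (fun n => x n * x n) i + x (S i) * x (S i)).
    specialize (Hp i). nra.
Qed.

Lemma ip_self_nonneg (x : vec) : l2 x -> 0 <= ip x x.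
Proof. intros Hx. generalize (ip_self_ge x 0 Hx) (pow2_ge_0 (x 0%nat)). lra. Qed.

Lemma ip_self_zero (x : vec) : l2 x -> ip x x = 0 -> x = vzero.
Proof.
  intros Hx H0. apply functional_extensionality. intro i.
  generalize (ip_self_ge x i Hx). rewrite H0. unfold vzero. nra.
Qed.

Lemma ip_self_lin (x y : vec) (t : R) : l2 x -> l2 y ->
  ip (vadd x (vscal t y)) (vadd x (vscal t y)) = ip x x + 2 * t * ip x y + t ^ 2 * ip y y.
Proof.
  intros Hx Hy.
  assert (Hty := l2_scal t y Hy).
  rewrite ip_add_l, ip_scal_l by auto using l2_add.
  rewrite (ip_comm x), (ip_comm y).
  rewrite !ip_add_l, !ip_scal_l by auto.
  rewrite (ip_comm y x). ring.
Qed.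

Lemma cauchy_schwarz (x y : vec) : l2 x -> l2 y -> ip x y ^ 2 <= ip x x * ip y y.
Proof.
  intros Hx Hy.
  destruct (Req_dec (ip y y) 0) as [Hz | Hz].
  - rewrite (ip_self_zero y Hy Hz) at 1.
    replace (ip x vzero) with 0.
    + rewrite Hz. lra.
    + rewrite ip_comm. replace vzero with (vscal 0 y) by vec_eq. rewrite ip_scal_l. ring.
  - assert (Hp := ip_self_nonneg y Hy).
    (* The scalar - <x,y> / <y,y> minimises the squared norm of x + t y; its non-negativity there is
       the claim divided by <y,y>. *)
    assert (Ht := ip_self_nonneg _ (l2_add _ _ Hx (l2_scal (- ip x y / ip y y) _ Hy))).
    rewrite ip_self_lin in Ht by assumption.
    replace (ip x x + 2 * (- ip x y / ip y y) * ip x y + (- ip x y / ip y y) ^ 2 * ip y y)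
      with ((ip x x * ip y y - ip x y ^ 2) / ip y y) in Ht by (field; assumption).
    apply Rmult_le_compat_r with (r := ip y y) in Ht; [ | lra ].
    unfold Rdiv in Ht. rewrite Rmult_assoc, Rinv_l in Ht by assumption. lra.
Qed.

Lemma vnorm_nonneg (x : vec) : 0 <= vnorm x.
Proof. apply sqrt_pos. Qed.

Lemma vnorm_sqr (x : vec) : l2 x -> vnorm x ^ 2 = ip x x.
Proof. intros Hx. apply pow2_sqrt. apply ip_self_nonneg; assumption. Qed.

Lemma vnorm_triangle (x y : vec) : l2 x -> l2 y -> vnorm (vadd x y) <= vnorm x + vnorm y.
Proof.
  intros Hx Hy.
  assert (Nx := vnorm_nonneg x). assert (Ny := vnorm_nonneg y).
  apply Rsqr_incr_0_var; [ | lra ]. rewrite !Rsqr_pow2.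
  rewrite (vnorm_sqr _ (l2_add _ _ Hx Hy)).
  replace (vadd x y) with (vadd x (vscal 1 y)) by vec_eq.
  rewrite ip_self_lin by assumption.
  replace ((vnorm x + vnorm y) ^ 2) with (vnorm x ^ 2 + 2 * (vnorm x * vnorm y) + vnorm y ^ 2)
    by ring.
  rewrite !vnorm_sqr by assumption.
  assert (ip x y <= vnorm x * vnorm y); [ | lra ].
  apply Rle_trans with (1 := Rle_abs _). apply Rsqr_incr_0_var; [ | nra ].
  rewrite <- Rsqr_abs, !Rsqr_pow2, Rpow_mult_distr, !vnorm_sqr by assumption.
  apply cauchy_schwarz; assumption.
Qed.

Lemma vnorm_scal (c : R) (x : vec) : l2 x -> vnorm (vscal c x) = Rabs c * vnorm x.
Proof.
  intros Hx. unfold vnorm. rewrite ip_scal_l, ip_comm, ip_scal_l, <- Rmult_assoc.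
  rewrite sqrt_mult; [ | nra | apply ip_self_nonneg; assumption ].
  f_equal. exact (sqrt_Rsqr_abs c).
Qed.

Lemma vnorm_zero_inv (x : vec) : l2 x -> vnorm x = 0 -> x = vzero.
Proof.
  intros Hx H0. apply ip_self_zero; [assumption | ].
  rewrite <- vnorm_sqr, H0 by assumption. ring.
Qed.

Lemma vnorm_vzero : vnorm vzero = 0.
Proof.
  replace vzero with (vscal 0 vzero) by vec_eq.
  rewrite vnorm_scal, Rabs_R0 by apply l2_zero. ring.
Qed.

Lemma l2_sub (x y : vec) : l2 x -> l2 y -> l2 (vsub x y).
Proof. intros Hx Hy. rewrite vsub_eq. auto using l2_add, l2_scal. Qed.

Lemma vdist_refl (x : vec) : vdist x x = 0.
Proof. unfold vdist. replace (vsub x x) with vzero by vec_eq. apply vnorm_vzero. Qed.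

Lemma vdist_sym (x y : vec) : vdist x y = vdist y x.
Proof.
  unfold vdist, vnorm. f_equal. apply Series_ext. intro n. unfold vsub. ring.
Qed.

Lemma vdist_triangle (x y z : vec) : l2 x -> l2 y -> l2 z ->
  vdist x z <= vdist x y + vdist y z.
Proof.
  intros Hx Hy Hz. unfold vdist.
  replace (vsub x z) with (vadd (vsub x y) (vsub y z)) by vec_eq.
  apply vnorm_triangle; apply l2_sub; assumption.
Qed.

Lemma vdist_pos (x y : vec) : l2 x -> l2 y -> x <> y -> 0 < vdist x y.
Proof.
  intros Hx Hy Hn. destruct (Rle_lt_or_eq_dec 0 (vdist x y)) as [H | H]; auto.
  - apply vnorm_nonneg.
  - exfalso. apply Hn. symmetry in H. apply vnorm_zero_inv in H; [ | apply l2_sub; assumption].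
    apply functional_extensionality. intro i.
    assert (Hi := f_equal (fun f => f i) H). unfold vsub, vzero in Hi. lra.
Qed.

(** * Spans and linear independence *)

(** The form used in [has_dim], with one coefficient per vector, since [lincomb] silently cuts the
    longer of its two lists. *)
Definition inspan (vs : list vec) (x : vec) : Prop :=
  exists cs, length cs = length vs /\ x = lincomb cs vs.

Lemma inspan_nil (x : vec) : inspan [] x <-> x = vzero.
Proof.
  split.
  - intros ([ | c cs] & Hl & ->); [reflexivity | discriminate].
  - intros ->. exists []. split; reflexivity.
Qed.

Lemma inspan_cons (v : vec) (vs : list vec) (x : vec) :
  inspan (v :: vs) x <-> exists c y, inspan vs y /\ x = vadd (vscal c v) y.
Proof.
  split.
  - intros ([ | c cs] & Hl & ->); [discriminate | ].
    exists c, (lincomb cs vs). split; [exists cs; auto | reflexivity].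
  - intros (c & y & (cs & Hl & ->) & ->). exists (c :: cs). split; [simpl; auto | reflexivity].
Qed.

Lemma inspan_zero (vs : list vec) : inspan vs vzero.
Proof.
  induction vs as [ | v vs IH].
  - now apply inspan_nil.
  - apply inspan_cons. exists 0, vzero. split; [assumption | vec_eq].
Qed.

Lemma inspan_add (vs : list vec) (x y : vec) :
  inspan vs x -> inspan vs y -> inspan vs (vadd x y).
Proof.
  revert x y. induction vs as [ | v vs IH]; intros x y.
  - rewrite !inspan_nil. intros -> ->. vec_eq.
  - rewrite !inspan_cons. intros (c & x' & Hx & ->) (d & y' & Hy & ->).
    exists (c + d), (vadd x' y'). split; [auto | vec_eq].
Qed.

Lemma inspan_scal (vs : list vec) (a : R) (x : vec) :
  inspan vs x -> inspan vs (vscal a x).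
Proof.
  revert x. induction vs as [ | v vs IH]; intros x.
  - rewrite !inspan_nil. intros ->. vec_eq.
  - rewrite !inspan_cons. intros (c & x' & Hx & ->).
    exists (a * c), (vscal a x'). split; [auto | vec_eq].
Qed.

Lemma inspan_sub (vs : list vec) (x y : vec) :
  inspan vs x -> inspan vs y -> inspan vs (vsub x y).
Proof. intros Hx Hy. rewrite vsub_eq. auto using inspan_add, inspan_scal. Qed.

Lemma inspan_weaken (v : vec) (vs : list vec) (x : vec) : inspan vs x -> inspan (v :: vs) x.
Proof. intros Hx. apply inspan_cons. exists 0, x. split; [assumption | vec_eq]. Qed.

Lemma inspan_in (vs : list vec) (v : vec) : In v vs -> inspan vs v.
Proof.
  induction vs as [ | w vs IH]; intros Hv.
  - destruct Hv.
  - destruct Hv as [<- | Hv]; [ | apply inspan_weaken; auto].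
    apply inspan_cons. exists 1, vzero. split; [apply inspan_zero | vec_eq].
Qed.

Lemma inspan_trans (vs ws : list vec) (x : vec) :
  (forall v, In v vs -> inspan ws v) -> inspan vs x -> inspan ws x.
Proof.
  revert x. induction vs as [ | v vs IH]; intros x Hv.
  - rewrite inspan_nil. intros ->. apply inspan_zero.
  - rewrite inspan_cons. intros (c & y & Hy & ->).
    apply inspan_add; [apply inspan_scal, Hv; now left | ].
    apply IH; [ | assumption]. intros u Hu. apply Hv. now right.
Qed.

Lemma inspan_closed (S : vec -> Prop) (vs : list vec) (x : vec) :
  lin_subspace l2 S -> Forall S vs -> inspan vs x -> S x.
Proof.
  intros (_ & H0 & Ha & Hs) Hvs. revert x. induction Hvs as [ | v vs Hv Hvs IH]; intro x.
  - rewrite inspan_nil. now intros ->.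
  - rewrite inspan_cons. intros (c & y & Hy & ->). auto.
Qed.

Lemma l2_subspace : lin_subspace l2 l2.
Proof. repeat split; auto using l2_zero, l2_add, l2_scal. Qed.

Lemma RN_subspace (N : nat) : lin_subspace l2 (RN N).
Proof.
  repeat split.
  - intro x. apply RN_l2.
  - intros x y Hx Hy i Hi. unfold vadd. rewrite Hx, Hy by assumption. ring.
  - intros c x Hx i Hi. unfold vscal. rewrite Hx by assumption. ring.
Qed.

Lemma inspan_l2 (vs : list vec) (x : vec) : Forall l2 vs -> inspan vs x -> l2 x.
Proof. apply inspan_closed, l2_subspace. Qed.

Lemma lin_indep_nil : lin_indep [].
Proof. intros [ | c cs] Hl _; [constructor | discriminate]. Qed.

Lemma lin_indep_cons (v : vec) (vs : list vec) :
  lin_indep (v :: vs) <-> lin_indep vs /\ ~ inspan vs v.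
Proof.
  split.
  - intros H. split.
    + intros cs Hl Hc. assert (Hf : Forall (fun c => c = 0) (0 :: cs)).
      { apply H; [simpl; auto | ]. change (vadd (vscal 0 v) (lincomb cs vs) = vzero).
        rewrite Hc. vec_eq. }
      now inversion Hf.
    + intros (cs & Hl & Hv). assert (Hf : Forall (fun c => c = 0) (-1 :: cs)).
      { apply H; [simpl; auto | ]. change (vadd (vscal (-1) v) (lincomb cs vs) = vzero).
        rewrite <- Hv. vec_eq. }
      inversion Hf. lra.
  - intros (Hi & Hn) [ | c cs] Hl Hc; [discriminate | ].
    change (vadd (vscal c v) (lincomb cs vs) = vzero) in Hc.
    destruct (Req_dec c 0) as [-> | Hc0].
    + constructor; [reflexivity | ]. apply Hi; [simpl in Hl; lia | ].
      rewrite <- Hc. vec_eq.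
    + exfalso. apply Hn. replace v with (vscal (- / c) (lincomb cs vs)).
      * apply inspan_scal. exists cs. simpl in Hl. split; [lia | reflexivity].
      * apply functional_extensionality. intro i.
        assert (Hci := f_equal (fun f => f i) Hc).
        unfold vadd, vscal, vzero in *. replace (lincomb cs vs i) with (- (c * v i)) by lra.
        field. assumption.
Qed.

(** Brings the pivot of [steinitz] to the front. Moving [w] past [v] is safe because a relation w =
    c v + y with c nonzero can be solved for [v]. *)
Lemma lin_indep_middle (ls rs : list vec) (w : vec) :
  lin_indep (ls ++ w :: rs) -> lin_indep (w :: ls ++ rs).
Proof.
  induction ls as [ | v ls IH]; simpl; [auto | ].
  rewrite lin_indep_cons. intros (Hi & Hn). apply IH in Hi.
  rewrite lin_indep_cons in Hi. destruct Hi as (Hi & Hw).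
  assert (Hn' : ~ inspan (w :: ls ++ rs) v).
  { intro Hv. apply Hn. apply inspan_trans with (2 := Hv).
    intros u [<- | Hu]; apply inspan_in; rewrite in_app_iff in *; simpl; tauto. }
  rewrite !lin_indep_cons. repeat split; auto using inspan_weaken.
  rewrite inspan_cons. intros (c & y & Hy & ->).
  destruct (Req_dec c 0) as [-> | Hc].
  - apply Hw. replace (vadd (vscal 0 v) y) with y by vec_eq. assumption.
  - apply Hn'. apply inspan_cons. exists (/ c), (vscal (- / c) y).
    split; [auto using inspan_scal | ]. vec_eq. field. assumption.
Qed.

(** A combination of the sheared vectors is the same combination of [vs] plus a multiple of [w], so
    a relation among them is a relation of [w :: vs]. *)
Lemma lin_indep_shear (w : vec) (vs : list vec) (f : vec -> R) :
  lin_indep (w :: vs) -> lin_indep (map (fun v => vsub v (vscal (f v) w)) vs).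
Proof.
  intros H cs Hl Hc. rewrite length_map in Hl.
  assert (He : exists s, lincomb cs (map (fun v => vsub v (vscal (f v) w)) vs)
                         = vadd (vscal s w) (lincomb cs vs)).
  { clear H Hc. revert cs Hl. induction vs as [ | v vs IH]; intros [ | c cs] Hl; try discriminate.
    - exists 0. simpl. unfold lincomb. simpl. vec_eq.
    - destruct (IH cs) as (s & Hs); [simpl in Hl; lia | ].
      exists (s - c * f v).
      change (vadd (vscal c (vsub v (vscal (f v) w)))
                (lincomb cs (map (fun v => vsub v (vscal (f v) w)) vs))
              = vadd (vscal (s - c * f v) w) (vadd (vscal c v) (lincomb cs vs))).
      rewrite Hs. vec_eq. }
  destruct He as (s & Hs). rewrite Hs in Hc.
  assert (Hf : Forall (fun c => c = 0) (s :: cs)) by (apply H; [simpl; auto | assumption]).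
  now inversion Hf.
Qed.

(* Clearing the coefficients of [b] with a pivot [w] shortens both lists by one. *)
Lemma steinitz (bs vs : list vec) :
  lin_indep vs -> Forall (inspan bs) vs -> (length vs <= length bs)%nat.
Proof.
  revert vs. induction bs as [ | b bs IH]; intros vs Hi Hs.
  - destruct vs as [ | v vs]; [auto | ]. exfalso.
    apply lin_indep_cons in Hi. apply Hi. inversion_clear Hs as [ | ? ? H _].
    apply inspan_nil in H. subst v. apply inspan_zero.
  - destruct (classic (Forall (inspan bs) vs)) as [Ha | Ha].
    { simpl. apply le_S. auto. }
    rewrite <- Exists_Forall_neg in Ha by (intro; apply classic).
    apply Exists_exists in Ha. destruct Ha as (w & Hw & Hnw).
    destruct (in_split _ _ Hw) as (ls & rs & ->).
    assert (Hi' := lin_indep_middle _ _ _ Hi).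
    rewrite Forall_forall in Hs.
    assert (Hex : forall v, In v (ls ++ rs) -> exists d, inspan bs (vsub v (vscal d w))).
    { intros v Hv.
      assert (Hv' : inspan (b :: bs) v) by (apply Hs; rewrite in_app_iff in *; simpl; tauto).
      apply Hs in Hw. apply inspan_cons in Hw, Hv'.
      destruct Hw as (c & y & Hy & ->), Hv' as (d & z & Hz & ->).
      destruct (Req_dec c 0) as [-> | Hc].
      - exfalso. apply Hnw. now replace (vadd (vscal 0 b) y) with y by vec_eq.
      - exists (d / c). replace (vsub (vadd (vscal d b) z) (vscal (d / c) (vadd (vscal c b) y)))
          with (vsub z (vscal (d / c) y)) by (vec_eq; field; assumption).
        auto using inspan_sub, inspan_scal. }
    pose (f := fun v => epsilon (inhabits 0) (fun d => inspan bs (vsub v (vscal d w)))).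
    assert (Hl := IH (map (fun v => vsub v (vscal (f v) w)) (ls ++ rs))).
    rewrite length_map, length_app in Hl. rewrite length_app. simpl.
    rewrite Nat.add_succ_r. apply le_n_S, Hl.
    + apply lin_indep_shear. assumption.
    + apply Forall_map, Forall_forall. intros v Hv. unfold f.
      apply epsilon_spec. auto.
Qed.

(** The vectors are treated from the last to the first, and each is kept only if it lies outside the
    span so far. The strict drop in length for a dependent list is what later makes fibers too
    large. *)
Lemma extract_basis (vs : list vec) :
  exists bs, lin_indep bs /\ incl bs vs /\ (forall v, In v vs -> inspan bs v) /\
    (~ lin_indep vs -> (length bs < length vs)%nat).
Proof.
  induction vs as [ | v vs (bs & Hi & Hb & Hs & Hl)].
  - exists []. repeat split; auto using lin_indep_nil, incl_refl.
    + intros v [].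
    + intros H. destruct (H lin_indep_nil).
  - assert (Hle : (length bs <= length vs)%nat).
    { apply steinitz; [assumption | ]. apply Forall_forall. auto using inspan_in. }
    destruct (classic (inspan bs v)) as [Hv | Hv].
    + exists bs. repeat split; auto using incl_tl.
      * intros u [<- | Hu]; auto.
      * simpl. lia.
    + exists (v :: bs). repeat split.
      * apply lin_indep_cons. auto.
      * apply incl_cons; [now left | auto using incl_tl].
      * intros u [<- | Hu]; [apply inspan_in; now left | apply inspan_weaken; auto].
      * intros Hn. simpl. apply le_n_S, Hl. intros Hvs. apply Hn, lin_indep_cons.
        split; [assumption | ]. intros Hv'. apply Hv.
        apply inspan_trans with (2 := Hv'). assumption.
Qed.

(** * Coordinate vectors and the dimension of R^N *)

Definition basis_vec (i : nat) : vec := fun j => if Nat.eq_dec i j then 1 else 0.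

(** The start [a] is arbitrary for the sake of the induction, which passes from [a] to [S a]. *)
Lemma lincomb_basis_vec (cs : list R) (a j : nat) :
  lincomb cs (map basis_vec (seq a (length cs))) j
  = if Compare_dec.le_lt_dec a j then nth (j - a) cs 0 else 0.
Proof.
  revert a. induction cs as [ | c cs IH]; intro a.
  - simpl. destruct (j - a)%nat; destruct (Compare_dec.le_lt_dec a j); reflexivity.
  - change (c * basis_vec a j + lincomb cs (map basis_vec (seq (S a) (length cs))) j
      = if Compare_dec.le_lt_dec a j then nth (j - a) (c :: cs) 0 else 0).
    rewrite IH. unfold basis_vec.
    destruct (Nat.eq_dec a j) as [-> | Hn].
    + destruct (Compare_dec.le_lt_dec (S j) j); [lia | ].
      destruct (Compare_dec.le_lt_dec j j); [ | lia]. rewrite Nat.sub_diag. simpl. ring.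
    + destruct (Compare_dec.le_lt_dec (S a) j), (Compare_dec.le_lt_dec a j); try lia; try ring.
      replace (j - a)%nat with (S (j - S a)) by lia. simpl. ring.
Qed.

Lemma basis_vec_indep (N : nat) : lin_indep (map basis_vec (seq 0 N)).
Proof.
  intros cs Hl Hc. rewrite length_map, length_seq in Hl. subst N.
  apply Forall_forall. intros c Hin. destruct (In_nth _ _ 0 Hin) as (i & Hi & <-).
  assert (H := f_equal (fun f => f i) Hc). cbv beta in H.
  rewrite lincomb_basis_vec in H. simpl in H. now rewrite Nat.sub_0_r in H.
Qed.

Lemma RN_spanned (N : nat) (x : vec) : RN N x -> inspan (map basis_vec (seq 0 N)) x.
Proof.
  intros Hx. exists (map x (seq 0 N)). rewrite !length_map. split; [reflexivity | ].
  apply functional_extensionality. intro j.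
  replace (seq 0 N) with (seq 0 (length (map x (seq 0 N)))) at 2
    by (now rewrite length_map, length_seq).
  rewrite lincomb_basis_vec. simpl. rewrite Nat.sub_0_r.
  destruct (Compare_dec.le_lt_dec N j).
  - rewrite nth_overflow by (rewrite length_map, length_seq; lia). auto.
  - rewrite nth_indep with (d' := x 0%nat) by (rewrite length_map, length_seq; lia).
    rewrite map_nth, seq_nth by lia. reflexivity.
Qed.

Lemma RN_basis_vec (N i : nat) : (i < N)%nat -> RN N (basis_vec i).
Proof. intros Hi j Hj. unfold basis_vec. destruct (Nat.eq_dec i j); [lia | reflexivity]. Qed.

(** Otherwise the N coordinate vectors would lie in the span, against [steinitz]. The [vs] may be
    any sequences, so the lemma also serves l_2. *)
Lemma RN_escape_span (N : nat) (vs : list vec) :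
  (length vs < N)%nat -> exists u, RN N u /\ ~ inspan vs u.
Proof.
  intros Hl. apply NNPP. intros Hno.
  assert (H := steinitz vs _ (basis_vec_indep N)).
  rewrite length_map, length_seq in H. assert (N <= length vs)%nat; [ | lia].
  apply H. apply Forall_map, Forall_forall. intros i Hi. apply NNPP. intros Hn.
  apply in_seq in Hi. apply Hno. exists (basis_vec i).
  split; [apply RN_basis_vec; lia | assumption].
Qed.

Lemma RN_indep_length (N : nat) (vs : list vec) :
  Forall (RN N) vs -> lin_indep vs -> (length vs <= N)%nat.
Proof.
  intros Hv Hi. rewrite <- (length_seq N 0), <- (length_map basis_vec).
  apply steinitz; [assumption | ].
  revert Hv. apply Forall_impl. apply RN_spanned.
Qed.

(** * Orthogonal projections and stability of linear independence *)

(** One Gram-Schmidt step: [r] is the part of [v] orthogonal to the span of [vs], and the projection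
    of [x] onto the larger span is its projection [p] onto the smaller one plus its component along
    [r]. *)
Lemma orth_proj_exists (vs : list vec) (x : vec) : Forall l2 vs -> l2 x ->
  exists p, inspan vs p /\ forall v, inspan vs v -> ip v (vsub x p) = 0.
Proof.
  intros Hvs. revert x. induction Hvs as [ | v vs Hv Hvs IH]; intros x Hx.
  - exists vzero. split; [apply inspan_zero | ]. intros v. rewrite inspan_nil. intros ->.
    replace vzero with (vscal 0 x) by vec_eq. rewrite ip_scal_l. ring.
  - destruct (IH v Hv) as (q & Hq & Hqo). destruct (IH x Hx) as (p & Hp & Hpo).
    assert (Lq := inspan_l2 _ _ Hvs Hq). assert (Lp := inspan_l2 _ _ Hvs Hp).
    set (r := vsub v q) in *. assert (Lr : l2 r) by (apply l2_sub; assumption).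
    assert (Hv' : v = vadd r q) by (unfold r; vec_eq).
    set (t := ip (vsub x p) r / ip r r).
    exists (vadd (vscal t r) p). split.
    + apply inspan_cons. exists t, (vsub p (vscal t q)). split.
      * apply inspan_sub; [ | apply inspan_scal]; assumption.
      * unfold r. vec_eq.
    + assert (Hxp : l2 (vsub x p)) by (apply l2_sub; assumption).
      assert (Horth : forall u, l2 u ->
        ip u (vsub x (vadd (vscal t r) p)) = ip u (vsub x p) - t * ip u r).
      { intros u Hu. rewrite !(ip_comm u).
        replace (vsub x (vadd (vscal t r) p)) with (vadd (vsub x p) (vscal (- t) r)) by vec_eq.
        rewrite ip_add_l, ip_scal_l by auto using l2_scal. ring. }
      assert (Hr0 : ip r (vsub x (vadd (vscal t r) p)) = 0).
      { rewrite Horth, (ip_comm r (vsub x p)) by assumption. unfold t.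
        (* For r = 0 the quotient [t] is a division by zero, but both inner products with [r]
           vanish. *)
        destruct (Req_dec (ip r r) 0) as [Hz | Hz].
        - apply ip_self_zero in Hz; [ | assumption]. rewrite Hz.
          assert (Hz0 : forall z, ip z vzero = 0).
          { intro z. rewrite ip_comm. replace vzero with (vscal 0 z) by vec_eq.
            rewrite ip_scal_l. ring. }
          rewrite !Hz0. ring.
        - field. assumption. }
      assert (Hs0 : forall u, inspan vs u -> ip u (vsub x (vadd (vscal t r) p)) = 0).
      { intros u Hu. rewrite Horth by eauto using inspan_l2.
        rewrite Hpo, Hqo by assumption. ring. }
      assert (Ld : l2 (vsub x (vadd (vscal t r) p)))
        by (apply l2_sub; [ | apply l2_add; [apply l2_scal | ] ]; assumption).
      intros u. rewrite inspan_cons. intros (c & y & Hy & ->).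
      assert (Ly := inspan_l2 _ _ Hvs Hy).
      rewrite ip_add_l, ip_scal_l by auto using l2_scal.
      rewrite (Hs0 y Hy). rewrite Hv' at 1. rewrite ip_add_l by assumption.
      rewrite Hr0, (Hs0 q Hq). ring.
Qed.

Definition abs_sum (cs : list R) : R := fold_right (fun c s => Rabs c + s) 0 cs.

Lemma abs_sum_nonneg (cs : list R) : 0 <= abs_sum cs.
Proof. induction cs as [ | c cs IH]; simpl; [lra | generalize (Rabs_pos c); lra]. Qed.

Lemma lincomb_l2 (cs : list R) (vs : list vec) :
  length cs = length vs -> Forall l2 vs -> l2 (lincomb cs vs).
Proof. intros Hl Hvs. apply (inspan_l2 vs); [assumption | ]. exists cs. auto. Qed.

(* With r the component of v orthogonal to the span of vs, |c| |r| <= |c v + s| for s in that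
   span, which bounds c and then s. *)
Lemma lin_indep_lower_bound (vs : list vec) : Forall l2 vs -> lin_indep vs ->
  exists d, 0 < d /\ forall cs, length cs = length vs ->
    d * abs_sum cs <= vnorm (lincomb cs vs).
Proof.
  intros Hvs. induction Hvs as [ | v vs Hv Hvs IH]; intro Hi.
  - exists 1. split; [lra | ]. intros [ | c cs] Hl; [ | discriminate].
    simpl. generalize (vnorm_nonneg (lincomb [] [])). lra.
  - apply lin_indep_cons in Hi. destruct Hi as (Hi & Hn).
    destruct (IH Hi) as (d & Hd & Hb).
    destruct (orth_proj_exists vs v Hvs Hv) as (p & Hp & Ho).
    assert (Lp := inspan_l2 _ _ Hvs Hp).
    set (r := vsub v p) in *. assert (Lr : l2 r) by (apply l2_sub; assumption).
    assert (Hr : 0 < vnorm r).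
    { destruct (vnorm_nonneg r) as [H | H]; [assumption | exfalso].
      apply Hn. symmetry in H. apply vnorm_zero_inv in H; [ | assumption].
      replace v with (vadd r p) by (unfold r; vec_eq). rewrite H.
      now replace (vadd vzero p) with p by vec_eq. }
    (* [K] adds the bounds |c| <= |z| / |r| and abs_sum cs <= (|z| + |c| |v|) / d, both expressed
       per unit of |z|. *)
    set (K := 1 / vnorm r + (1 + vnorm v / vnorm r) / d).
    assert (Hvn := vnorm_nonneg v).
    assert (HK : 0 < K).
    { assert (0 < 1 / vnorm r) by (apply Rdiv_lt_0_compat; lra).
      assert (0 <= vnorm v / vnorm r) by (apply Rdiv_le_0_compat; lra).
      assert (0 < (1 + vnorm v / vnorm r) / d) by (apply Rdiv_lt_0_compat; lra).
      unfold K. lra. }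
    exists (/ K). split; [now apply Rinv_0_lt_compat | ].
    intros [ | c cs] Hl; [discriminate | ].
    assert (Hl' : length cs = length vs) by (simpl in Hl; lia).
    change (/ K * (Rabs c + abs_sum cs) <= vnorm (vadd (vscal c v) (lincomb cs vs))).
    set (s := lincomb cs vs). assert (Ls : l2 s) by now apply lincomb_l2.
    set (z := vadd (vscal c v) s).
    assert (Lz : l2 z) by (apply l2_add; auto using l2_scal).
    assert (Hc : Rabs c * vnorm r <= vnorm z).
    { apply Rsqr_incr_0_var; [ | apply vnorm_nonneg].
      rewrite !Rsqr_pow2, Rpow_mult_distr, !vnorm_sqr, <- !Rsqr_pow2, <- Rsqr_abs, Rsqr_pow2
        by assumption.
      (* Since z = w + c r with [w] in the span of [vs] and [r] orthogonal to it, Pythagoras leaves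
         |c| |r| as a lower bound. *)
      set (w := vadd (vscal c p) s).
      assert (Lw : l2 w) by (apply l2_add; auto using l2_scal).
      assert (Hw : inspan vs w).
      { apply inspan_add; [now apply inspan_scal | ]. exists cs. auto. }
      replace z with (vadd w (vscal c r)) by (unfold z, w, r; vec_eq).
      rewrite ip_self_lin, (Ho w Hw) by assumption.
      generalize (ip_self_nonneg w Lw). lra. }
    assert (Hs : d * abs_sum cs <= vnorm z + Rabs c * vnorm v).
    { apply Rle_trans with (1 := Hb cs Hl'). fold s.
      replace s with (vadd z (vscal (- c) v)) by (unfold z; vec_eq).
      apply Rle_trans with (1 := vnorm_triangle _ _ Lz (l2_scal _ _ Hv)).
      rewrite vnorm_scal, Rabs_Ropp by assumption. lra. }
    assert (Hc' : Rabs c <= vnorm z / vnorm r) by (apply Rle_div_r; assumption).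
    assert (Hs' : abs_sum cs <= (vnorm z + vnorm z / vnorm r * vnorm v) / d).
    { apply Rle_div_r; [assumption | ]. rewrite Rmult_comm.
      apply Rle_trans with (1 := Hs). apply Rplus_le_compat_l, Rmult_le_compat_r; assumption. }
    apply Rle_trans with (/ K * (K * vnorm z)).
    + apply Rmult_le_compat_l; [left; now apply Rinv_0_lt_compat | ].
      replace (K * vnorm z)
        with (vnorm z / vnorm r + (vnorm z + vnorm z / vnorm r * vnorm v) / d); [lra | ].
      unfold K. field. lra.
    + rewrite <- Rmult_assoc, Rinv_l, Rmult_1_l by lra. lra.
Qed.

Lemma lincomb_perturb (e : R) (cs : list R) (vs ws : list vec) :
  length cs = length vs -> Forall2 (fun v w => l2 v /\ l2 w /\ vdist v w <= e) vs ws ->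
  vnorm (lincomb cs vs) <= vnorm (lincomb cs ws) + e * abs_sum cs.
Proof.
  intros Hl H. revert cs Hl.
  assert (Hgen : forall cs, length cs = length vs ->
    l2 (vsub (lincomb cs vs) (lincomb cs ws)) /\ l2 (lincomb cs ws) /\
    vnorm (vsub (lincomb cs vs) (lincomb cs ws)) <= e * abs_sum cs).
  { induction H as [ | v w vs ws (Hv & Hw & Hd) H IH]; intros [ | c cs] Hl; try discriminate.
    - unfold lincomb. simpl. replace (vsub vzero vzero) with vzero by vec_eq.
      repeat split; auto using l2_zero. rewrite vnorm_vzero. lra.
    - destruct (IH cs) as (L1 & L2 & Hb); [simpl in Hl; lia | ].
      assert (L0 : l2 (vsub v w)) by (apply l2_sub; assumption).
      replace (vsub (lincomb (c :: cs) (v :: vs)) (lincomb (c :: cs) (w :: ws)))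
        with (vadd (vscal c (vsub v w)) (vsub (lincomb cs vs) (lincomb cs ws)))
        by (unfold lincomb; simpl; vec_eq).
      repeat split.
      + apply l2_add; auto using l2_scal.
      + apply l2_add; auto using l2_scal.
      + apply Rle_trans with (1 := vnorm_triangle _ _ (l2_scal _ _ L0) L1).
        rewrite vnorm_scal by assumption. simpl abs_sum.
        assert (Rabs c * vnorm (vsub v w) <= Rabs c * e)
          by (apply Rmult_le_compat_l; [apply Rabs_pos | exact Hd]).
        lra. }
  intros cs Hl. destruct (Hgen cs Hl) as (L1 & L2 & Hb).
  replace (lincomb cs vs) with (vadd (lincomb cs ws) (vsub (lincomb cs vs) (lincomb cs ws)))
    by vec_eq.
  apply Rle_trans with (1 := vnorm_triangle _ _ L2 L1). lra.
Qed.

(** If a combination of [ws] vanishes, the same combination of [vs] has norm at most d/2 times the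
    sum of the |c_i|, while the lower bound is d times that sum; so all c_i are zero. *)
Lemma lin_indep_open (vs : list vec) : Forall l2 vs -> lin_indep vs ->
  exists e, 0 < e /\ forall ws,
    Forall2 (fun v w => l2 w /\ vdist v w < e) vs ws -> lin_indep ws.
Proof.
  intros Hvs Hi. destruct (lin_indep_lower_bound vs Hvs Hi) as (d & Hd & Hb).
  exists (d / 2). split; [lra | ]. intros ws H cs Hl Hc.
  assert (Hlen := Forall2_length H).
  assert (H' : Forall2 (fun v w => l2 v /\ l2 w /\ vdist v w <= d / 2) vs ws).
  { clear - Hvs H. induction H as [ | v w vs ws (Hw & Hd) H IH]; constructor.
    - inversion_clear Hvs. repeat split; auto. lra.
    - apply IH. now inversion_clear Hvs. }
  rewrite <- Hlen in Hl.
  assert (Hp := lincomb_perturb _ cs _ _ Hl H').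
  rewrite Hc, vnorm_vzero in Hp. specialize (Hb cs Hl).
  assert (H0 : abs_sum cs = 0) by (generalize (abs_sum_nonneg cs); nra).
  clear - H0. induction cs as [ | c cs IH]; constructor; simpl in H0;
    generalize (abs_sum_nonneg cs) (Rabs_pos c); intros.
  - destruct (Req_dec c 0) as [ | Hc]; [assumption | ]. apply Rabs_pos_lt in Hc. lra.
  - apply IH. lra.
Qed.

(** * Compact sets and the Hausdorff distance *)

(** The minimum of the finitely many radii works, because [P] persists when the radius shrinks. *)
Lemma uniform_radius {T : Type} (l : list T) (P : T -> R -> Prop) :
  (forall a e e', P a e -> 0 < e' <= e -> P a e') ->
  (forall a, In a l -> exists e, 0 < e /\ P a e) ->
  exists e, 0 < e /\ forall a, In a l -> P a e.
Proof.
  intros Hanti. induction l as [ | a l IH]; intros H.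
  - exists 1. split; [lra | ]. intros a Ha. destruct Ha.
  - destruct IH as (e1 & H1 & IH); [intros; apply H; now right | ].
    destruct (H a) as (e2 & H2 & Ha); [now left | ].
    assert (Hm := Rmin_glb_lt _ _ _ H1 H2).
    exists (Rmin e1 e2). split; [assumption | ]. intros b Hb. destruct Hb as [<- | Hb].
    + apply (Hanti _ _ _ Ha). split; [assumption | apply Rmin_r].
    + apply (Hanti _ _ _ (IH b Hb)). split; [assumption | apply Rmin_l].
Qed.

Lemma open_ball (S : vec -> Prop) (x : vec) (e : R) :
  (forall y, S y -> l2 y) -> S x -> open_in S (fun y => S y /\ vdist x y < e).
Proof.
  intros HS Hx. split; [tauto | ]. intros y (Hy & Hd).
  exists (e - vdist x y). split; [lra | ]. intros z Hz Hyz. split; [assumption | ].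
  generalize (vdist_triangle x y z (HS _ Hx) (HS _ Hy) (HS _ Hz)). lra.
Qed.

(** Covers in [compact_in] are indexed by a whole type; the guard makes the set of an unsuitable
    index empty, hence open. *)
Lemma open_guard (S U : vec -> Prop) (P : Prop) :
  (P -> open_in S U) -> open_in S (fun y => P /\ U y).
Proof.
  intros H. split.
  - intros x (HP & HU). now apply (proj1 (H HP)).
  - intros x (HP & HU). destruct (proj2 (H HP) x HU) as (e & He & Hb). exists e. auto.
Qed.

(** As for a Lebesgue number: finitely many balls of half radius cover [K], and [e] is at most each
    half radius, so a point within [e] of [K] lies in one of the full balls. *)
Lemma compact_uniform (S K : vec -> Prop) (O : vec -> R -> Prop) :
  (forall y, S y -> l2 y) -> compact_in S K ->
  (forall y e e', O y e -> 0 < e' <= e -> O y e') ->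
  (forall x, K x -> exists e, 0 < e /\ forall y, S y -> vdist x y < e -> O y e) ->
  exists e, 0 < e /\ forall x y, K x -> S y -> vdist x y < e -> O y e.
Proof.
  intros HS (HKS & Hcov) Hanti Hloc.
  pose (good := fun p : vec * R =>
    S (fst p) /\ 0 < snd p /\ forall y, S y -> vdist (fst p) y < snd p -> O y (snd p)).
  destruct (Hcov (vec * R)%type
    (fun p y => good p /\ S y /\ vdist (fst p) y < snd p / 2)) as (l & Hl).
  - intros p. apply open_guard. intros (Hp & _). now apply open_ball.
  - intros x Hx. destruct (Hloc x Hx) as (e & He & H). exists (x, e).
    unfold good. simpl. rewrite vdist_refl. repeat split; auto. lra.
  - destruct (uniform_radius l (fun p e => good p -> e <= snd p / 2)) as (e & He & Hle).
    + intros p e e' H He Hg. specialize (H Hg). lra.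
    + intros p _. destruct (classic (good p)) as [Hg | Hg].
      * exists (snd p / 2). destruct Hg as (_ & Hg & _). split; intros; lra.
      * exists 1. split; [lra | tauto].
    + exists e. split; [assumption | ]. intros x y Hx Hy Hd.
      destruct (Hl x Hx) as (p & Hin & Hg & HSx & Hpx).
      assert (Hep := Hle p Hin Hg). destruct Hg as (Hp & Hp0 & Hgo).
      apply (Hanti y (snd p)); [ | lra]. apply Hgo; [assumption | ].
      generalize (vdist_triangle _ x y (HS _ Hp) (HS _ HSx) (HS _ Hy)). lra.
Qed.

Definition near_pair (S : vec -> Prop) (e : R) (p q : vec * vec) : Prop :=
  S (fst q) /\ S (snd q) /\ vdist (fst p) (fst q) < e /\ vdist (snd p) (snd q) < e.

Definition pair_in (M : vec -> Prop) (p : vec * vec) : Prop := M (fst p) /\ M (snd p).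

Lemma near_pair_le (S : vec -> Prop) (e e' : R) (xs ys : list (vec * vec)) :
  e' <= e -> Forall2 (near_pair S e') xs ys -> Forall2 (near_pair S e) xs ys.
Proof.
  intros He. apply Forall2_impl. intros p q (H1 & H2 & H3 & H4). repeat split; auto; lra.
Qed.

(** In effect the compactness of (K x K)^n, without a topology on lists. The induction peels off one
    pair and uses [compact_uniform] once for each of its two points; [Q] varies so that it can
    absorb that pair. *)
Lemma tube_lemma (S K : vec -> Prop) (n : nat) (Q : list (vec * vec) -> R -> Prop) :
  (forall y, S y -> l2 y) -> compact_in S K ->
  (forall ys e e', Q ys e -> 0 < e' <= e -> Q ys e') ->
  (forall xs, length xs = n -> Forall (pair_in K) xs ->
     exists e, 0 < e /\ forall ys, Forall2 (near_pair S e) xs ys -> Q ys e) ->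
  exists e, 0 < e /\ forall xs ys, length xs = n -> Forall (pair_in K) xs ->
     Forall2 (near_pair S e) xs ys -> Q ys e.
Proof.
  intros HS HK. revert Q. induction n as [ | n IH]; intros Q Hanti Hloc.
  - destruct (Hloc []) as (e & He & H); auto. exists e. split; [assumption | ].
    intros [ | x xs] ys Hl _ H2; [ | discriminate]. auto.
  - pose (tail := fun (A B : vec) (e : R) => forall xs ys, length xs = n ->
      Forall (pair_in K) xs -> Forall2 (near_pair S e) xs ys -> Q ((A, B) :: ys) e).
    assert (Htail : forall A B e e', tail A B e -> 0 < e' <= e -> tail A B e').
    { intros A B e e' H He xs ys Hl Hx H2. apply (Hanti _ e); [ | assumption].
      apply (H xs); auto. apply near_pair_le with (2 := H2). lra. }
    destruct (compact_uniform S K (fun A e => forall b B, K b -> S B -> vdist b B < e -> tail A B e)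
      HS HK) as (e & He & H).
    + intros A e e' H He b B Hb HB Hd. apply (Htail _ _ e); [ | assumption].
      apply (H b); auto. lra.
    (* With the first point near a fixed [a], compactness is used again for the second point; for
       fixed [a] and [b] the induction hypothesis applies. *)
    + intros a Ha. destruct (compact_uniform S K
        (fun B e => forall A, S A -> vdist a A < e -> tail A B e) HS HK) as (e & He & H).
      * intros B e e' H He A HA Hd. apply (Htail _ _ e); [ | assumption].
        apply H; auto. lra.
      * intros b Hb. destruct (IH (fun ys e => forall A B, near_pair S e (a, b) (A, B) ->
          Q ((A, B) :: ys) e)) as (e & He & H).
        -- intros ys e e' H He A B (H1 & H2 & H3 & H4). simpl in *.
           apply (Hanti _ e); [ | assumption]. apply H. repeat split; simpl; auto; lra.
        -- intros xs Hl Hxs. destruct (Hloc ((a, b) :: xs)) as (e & He & H).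
           ++ simpl. auto.
           ++ constructor; [split | ]; assumption.
           ++ exists e. split; [assumption | ]. intros ys H2 A B HAB. apply H.
              constructor; assumption.
        -- exists e. split; [assumption | ]. intros B HB Hd A HA Hd' xs ys Hl Hx H2.
           apply (H xs ys); auto. repeat split; auto.
      * exists e. split; [assumption | ]. intros A HA Hd b B Hb HB Hd'. apply (H b B); auto.
    + exists e. split; [assumption | ]. intros [ | (a, b) xs] zs Hl Hx H2; [discriminate | ].
      inversion H2 as [ | ? (A, B) ? ys (H21 & H22 & H23 & H24) H25]. subst. simpl in *.
      inversion_clear Hx as [ | ? ? (Ha & Hb) Hxs]. simpl in *.
      apply (H a A Ha H21 H23 b B Hb H22 H24 xs ys); auto.
Qed.

Lemma finite_net (S M : vec -> Prop) (e : R) :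
  (forall y, S y -> l2 y) -> compact_in S M -> 0 < e ->
  exists l, Forall M l /\ forall x, M x -> exists y, In y l /\ vdist y x < e.
Proof.
  intros HS (HMS & Hcov) He.
  destruct (Hcov vec (fun c y => M c /\ S y /\ vdist c y < e)) as (l & Hl).
  - intros c. apply open_guard. intros Hc. apply open_ball; auto.
  - intros x Hx. exists x. rewrite vdist_refl. auto.
  (* The subcover may contain centres outside [M], whose guarded balls are empty; dropping them
     leaves a net in [M]. *)
  - exists (filter (fun c => if excluded_middle_informative (M c) then true else false) l).
    split.
    + apply Forall_forall. intros c Hc. apply filter_In in Hc. destruct Hc as (_ & Hc).
      now destruct (excluded_middle_informative (M c)).
    + intros x Hx. destruct (Hl x Hx) as (c & Hc & HMc & _ & Hd). exists c.
      split; [ | assumption]. apply filter_In. split; [assumption | ].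
      now destruct (excluded_middle_informative (M c)).
Qed.

Lemma compact_bounded (S M : vec -> Prop) (x0 : vec) :
  (forall y, S y -> l2 y) -> compact_in S M -> S x0 ->
  exists C, forall y, M y -> vdist x0 y <= C.
Proof.
  intros HS HM Hx0. destruct (finite_net S M 1 HS HM Rlt_0_1) as (l & Hl & Hnet).
  assert (HC : exists C, forall y, In y l -> vdist x0 y <= C).
  { clear. induction l as [ | z l (C & IH)].
    - exists 0. intros y Hy. destruct Hy.
    - exists (Rmax C (vdist x0 z)). intros y Hy. destruct Hy as [<- | Hy].
      + apply Rmax_r.
      + apply Rle_trans with (2 := Rmax_l _ _). auto. }
  destruct HC as (C & HC). exists (C + 1). intros y Hy.
  destruct (Hnet y Hy) as (z & Hz & Hd). rewrite Forall_forall in Hl.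
  generalize (HC z Hz) (vdist_triangle x0 z y (HS _ Hx0) (HS _ (proj1 HM _ (Hl z Hz)))
    (HS _ (proj1 HM _ Hy))). lra.
Qed.

(** * The Hausdorff excess in terms of points *)

(** [real] sends infinite values to 0, so these are excluded first: [E] is non-empty and bounded
    below by 0. *)
Lemma real_glb (E : R -> Prop) (r0 : R) : E r0 -> (forall r, E r -> 0 <= r) ->
  (forall r, E r -> real (Glb_Rbar E) <= r) /\
  (forall e, real (Glb_Rbar E) < e -> exists r, E r /\ r < e).
Proof.
  intros H0 Hpos. destruct (Glb_Rbar_correct E) as (Hlb & Hglb).
  destruct (Glb_Rbar E) as [g | | ]; simpl.
  - split; [exact Hlb | ]. intros e He. apply NNPP. intros Hno.
    assert (H := Hglb (Finite e)). simpl in H. assert (e <= g); [ | lra]. apply H.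
    intros r Hr. simpl. apply Rnot_lt_le. intro Hlt. apply Hno. exists r. auto.
  - destruct (Hlb r0 H0).
  - destruct (Hglb (Finite 0)). exact Hpos.
Qed.

Lemma real_lub (E : R -> Prop) (r0 C : R) : E r0 -> (forall r, E r -> r <= C) ->
  (forall r, E r -> r <= real (Lub_Rbar E)) /\ real (Lub_Rbar E) <= C.
Proof.
  intros H0 HC. destruct (Lub_Rbar_correct E) as (Hub & Hlub).
  destruct (Lub_Rbar E) as [g | | ]; simpl.
  - split; [exact Hub | ]. apply (Hlub (Finite C)). exact HC.
  - destruct (Hlub (Finite C)). exact HC.
  - destruct (Hub r0 H0).
Qed.

Lemma pt_set_dist_spec (a : vec) (B : vec -> Prop) : (exists b, B b) ->
  (forall b, B b -> pt_set_dist a B <= vdist a b) /\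
  (forall e, pt_set_dist a B < e -> exists b, B b /\ vdist a b < e).
Proof.
  intros (b0 & Hb0).
  destruct (real_glb (fun r => exists b, B b /\ r = vdist a b) (vdist a b0)) as (H1 & H2).
  - eauto.
  - intros r (b & _ & ->). apply vnorm_nonneg.
  - split.
    + intros b Hb. apply H1. eauto.
    + intros e He. destruct (H2 e He) as (r & (b & Hb & ->) & Hlt). eauto.
Qed.

(** The supremum in [excess] bounds the distances of the points of [A] only if it is finite. It is,
    since compact sets are bounded and the distance to [B] is at most the distance to one point [b0]
    of it. *)
Lemma excess_lt (S A B : vec -> Prop) (e : R) :
  (forall y, S y -> l2 y) -> Kset S A -> Kset S B -> excess A B < e ->
  forall a, A a -> exists b, B b /\ vdist a b < e.
Proof.
  intros HS (HA & _) (HB & Hne) He a Ha. destruct Hne as (b0 & Hb0).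
  assert (Sb0 := proj1 HB _ Hb0).
  destruct (compact_bounded S A b0 HS HA Sb0) as (C & HC).
  apply pt_set_dist_spec; [eauto | ]. apply Rle_lt_trans with (2 := He).
  apply (real_lub (fun r => exists a, A a /\ r = pt_set_dist a B) (pt_set_dist a B) C); eauto.
  intros r (a' & Ha' & ->). apply Rle_trans with (vdist a' b0).
  - now apply pt_set_dist_spec; [exists b0 | ].
  - rewrite vdist_sym. auto.
Qed.

Lemma excess_le (A B : vec -> Prop) (e : R) : (exists a, A a) ->
  (forall a, A a -> exists b, B b /\ vdist a b <= e) -> excess A B <= e.
Proof.
  intros (a0 & Ha0) H.
  apply (real_lub (fun r => exists a, A a /\ r = pt_set_dist a B) (pt_set_dist a0 B) e); eauto.
  intros r (a & Ha & ->). destruct (H a Ha) as (b & Hb & Hd).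
  apply Rle_trans with (2 := Hd). apply pt_set_dist_spec; eauto.
Qed.

Lemma finite_Kset (S : vec -> Prop) (l : list vec) :
  l <> [] -> Forall S l -> Kset S (fun x => In x l).
Proof.
  intros Hne Hl. split.
  - split; [now apply Forall_forall | ]. intros I U _. clear Hne Hl.
    induction l as [ | x l IH]; intros Hcov.
    + exists []. intros x Hx. destruct Hx.
    + destruct IH as (is & His); [intros; apply Hcov; now right | ].
      destruct (Hcov x) as (i & Hi); [now left | ].
      exists (i :: is). intros y Hy. destruct Hy as [<- | Hy].
      * exists i. split; [now left | assumption].
      * destruct (His y Hy) as (j & Hj & HU). exists j. split; [now right | assumption].
  - destruct l as [ | x l]; [congruence | ]. exists x. now left.
Qed.

(** * General position and star lists *)

(** Centres may repeat, so the pairs are the edges of disjoint stars. The type is arbitrary because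
    both points and index patterns are treated. *)
Definition star {T : Type} (l : list (T * T)) : Prop :=
  NoDup (map fst l) /\ forall p q, In p l -> In q l -> fst p <> snd q.

Definition diffs (l : list (vec * vec)) : list vec := map (fun p => vsub (fst p) (snd p)) l.

(** In R^N more than N differences are always dependent, hence the restriction to admissible
    lengths. *)
Definition star_indep (adm : nat -> Prop) (M : vec -> Prop) : Prop :=
  forall l, adm (length l) -> star l -> Forall (pair_in M) l -> lin_indep (diffs l).

Definition vec_eq_dec (x y : vec) : {x = y} + {x <> y} := excluded_middle_informative (x = y).

Lemma star_const {T : Type} (c : T) (l : list T) :
  NoDup l -> ~ In c l -> star (map (fun x => (x, c)) l).
Proof.
  intros Hl Hc. split.
  - rewrite map_map. simpl. now rewrite map_id.
  - intros p q Hp Hq. apply in_map_iff in Hp, Hq.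
    destruct Hp as (x & <- & Hx), Hq as (y & <- & _). simpl. now intros ->.
Qed.

(** * Counting the points of fibers *)

Lemma NoDup_remove_all (x : vec) (l : list vec) : NoDup l -> NoDup (remove vec_eq_dec x l).
Proof.
  intros Hl. induction Hl as [ | y l Hy Hl IH]; simpl; [constructor | ].
  destruct (vec_eq_dec x y); [assumption | constructor; [ | assumption]].
  intro H. apply in_remove in H. tauto.
Qed.

Lemma length_remove_ge (x : vec) (l : list vec) :
  NoDup l -> (length l - 1 <= length (remove vec_eq_dec x l))%nat.
Proof.
  intros Hl. assert (H := NoDup_incl_length (l' := x :: remove vec_eq_dec x l) Hl).
  simpl in H. assert (length l <= S (length (remove vec_eq_dec x l)))%nat; [ | lia].
  apply H. intros y Hy. destruct (vec_eq_dec y x) as [-> | Hn].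
  - now left.
  - right. now apply in_in_remove.
Qed.

(** When each centre lies in its repetition-free list, the number of pairs is the sum of the |F(A)|
    - 1 in [gen_pos]. *)
Definition unfold_stars (reps : list (vec * list vec)) : list (vec * vec) :=
  flat_map (fun p => map (fun a => (a, fst p)) (remove vec_eq_dec (fst p) (snd p))) reps.

Lemma in_unfold_stars (reps : list (vec * list vec)) (q : vec * vec) :
  In q (unfold_stars reps) ->
  exists p, In p reps /\ snd q = fst p /\ In (fst q) (snd p) /\ fst q <> fst p.
Proof.
  intros Hq. apply in_flat_map in Hq. destruct Hq as (p & Hp & Hq).
  apply in_map_iff in Hq. destruct Hq as (a & <- & Ha). apply in_remove in Ha.
  exists p. simpl. tauto.
Qed.

(** The map [f], later the projection, is constant on each fiber and separates the representatives.
    So leaves of different fibers differ, and a leaf equal to a centre would lie in the fiber of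
    that centre, from which the centre was removed. *)
Lemma unfold_stars_star (f : vec -> vec) (reps : list (vec * list vec)) :
  (forall p, In p reps -> NoDup (snd p) /\ forall a, In a (snd p) -> f a = f (fst p)) ->
  ForallOrdPairs (fun p q => f (fst p) <> f (fst q)) reps ->
  star (unfold_stars reps).
Proof.
  intros Hreps Hord. split.
  - induction Hord as [ | p reps Hp Hord IH]; [constructor | ].
    simpl. rewrite map_app, map_map, map_id. apply NoDup_app.
    + apply NoDup_remove_all, Hreps. now left.
    + apply IH. intros q Hq. apply Hreps. now right.
    + intros a Ha Ha'. apply in_remove in Ha. apply in_map_iff in Ha'.
      destruct Ha' as (q & <- & Hq). apply in_unfold_stars in Hq.
      destruct Hq as (r & Hr & _ & Hqr & _). rewrite Forall_forall in Hp.
      apply (Hp r Hr).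
      rewrite <- (proj2 (Hreps p (or_introl eq_refl)) (fst q)) by tauto.
      now apply (Hreps r (or_intror Hr)).
  - intros q q' Hq Hq' Heq. apply in_unfold_stars in Hq, Hq'.
    destruct Hq as (p & Hp & _ & Hin & Hne), Hq' as (p' & Hp' & Hs & _).
    rewrite Heq, Hs in Hin, Hne.
    assert (Hf := proj2 (Hreps p Hp) _ Hin).
    destruct (ForallOrdPairs_In Hord p p' Hp Hp') as [-> | [H | H]]; congruence.
Qed.

Lemma unfold_stars_length (reps : list (vec * list vec)) :
  (forall p, In p reps -> NoDup (snd p)) ->
  (fold_right (fun p acc => (length (snd p) - 1) + acc) 0 reps
   <= length (unfold_stars reps))%nat.
Proof.
  induction reps as [ | p reps IH]; intros H; simpl; [lia | ].
  rewrite length_app, length_map.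
  assert (H1 := length_remove_ge (fst p) (snd p) (H p (or_introl eq_refl))).
  assert (H2 := IH (fun q Hq => H q (or_intror Hq))). lia.
Qed.

(** The entries of [l] are distinct and lie in the fibers with their centres removed; a fiber
    contains its centre, so the removal shortens it by at least one. *)
Lemma fibers_cover_length (reps : list (vec * list vec)) (l : list vec) :
  (forall p, In p reps -> In (fst p) (snd p)) -> NoDup l ->
  (forall a, In a l -> exists p, In p reps /\ In a (snd p) /\ a <> fst p) ->
  (length l <= fold_right (fun p acc => (length (snd p) - 1) + acc) 0 reps)%nat.
Proof.
  intros Hr Hn Hcov.
  apply Nat.le_trans with (length (flat_map (fun p => remove vec_eq_dec (fst p) (snd p)) reps)).
  - apply NoDup_incl_length; [assumption | ]. intros a Ha. apply in_flat_map.
    destruct (Hcov a Ha) as (p & Hp & Hap & Hne). exists p. split; [assumption | ].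
    now apply in_in_remove.
  - clear Hcov Hn. induction reps as [ | p reps IH]; simpl; [lia | ].
    rewrite length_app.
    assert (H1 := remove_length_lt vec_eq_dec (snd p) (fst p) (Hr p (or_introl eq_refl))).
    assert (H2 := IH (fun q Hq => Hr q (or_intror Hq))). lia.
Qed.

(** Otherwise every list satisfying [P] could be extended, up to length k + 1. This turns bounds on
    finite subsets into finite enumerations. *)
Lemma maximal_list {T : Type} (P : list T -> Prop) (k : nat) :
  P [] -> (forall l, P l -> (length l <= k)%nat) ->
  exists l, P l /\ forall x, ~ P (x :: l).
Proof.
  intros H0 Hk. apply NNPP. intros Hno.
  assert (H : forall n, exists l, P l /\ length l = n).
  { induction n as [ | n (l & Hl & Hn)].
    - exists []. auto.
    - apply NNPP. intros Hno'. apply Hno. exists l. split; [assumption | ].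
      intros x Hx. apply Hno'. exists (x :: l). simpl. auto. }
  destruct (H (S k)) as (l & Hl & Hn). apply Hk in Hl. lia.
Qed.

Lemma select_representatives (f : vec -> vec) (l : list vec) :
  exists r, incl r l /\ ForallOrdPairs (fun a b => f a <> f b) r /\
    forall x, In x l -> exists y, In y r /\ f x = f y.
Proof.
  induction l as [ | x l (r & Hi & Ho & Hc)].
  - exists []. repeat split; [apply incl_refl | constructor | ]. intros x Hx. destruct Hx.
  - destruct (classic (exists y, In y r /\ f x = f y)) as [Hx | Hx].
    + exists r. repeat split; auto using incl_tl. intros z [<- | Hz]; auto.
    + exists (x :: r). repeat split.
      * apply incl_cons; [now left | now apply incl_tl].
      * constructor; [ | assumption]. apply Forall_forall. intros y Hy Heq. apply Hx. eauto.
      * intros z [<- | Hz]; [exists x; split; [now left | reflexivity] | ].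
        destruct (Hc z Hz) as (y & Hy & Heq). exists y. split; [now right | assumption].
Qed.

Lemma ForallOrdPairs_map {T U : Type} (g : T -> U) (P : U -> U -> Prop) (l : list T) :
  ForallOrdPairs (fun a b => P (g a) (g b)) l -> ForallOrdPairs P (map g l).
Proof.
  intros H. induction H as [ | x l Hx H IH]; simpl; constructor; [ | assumption].
  now apply Forall_map.
Qed.

(** * Orthogonal projections and general position *)

Lemma has_dim_spec (H : vec -> Prop) (k : nat) : has_dim H k <->
  exists b, length b = k /\ lin_indep b /\ forall h, H h <-> inspan b h.
Proof.
  split; intros (b & Hb & Hi & Hs); exists b; (repeat split; [assumption | assumption | | ]);
    intros Hh; unfold inspan in *; [rewrite Hb; now apply Hs | apply Hs; now rewrite <- Hb
      | rewrite <- Hb; now apply Hs | apply Hs; now rewrite Hb].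
Qed.

(** The choice in [projp] is meaningful once a suitable point exists; a finite basis of [H] provides
    it through [orth_proj_exists]. *)
Lemma projp_spec (S H : vec -> Prop) (k : nat) (x : vec) :
  lin_subspace l2 S -> lin_subspace S H -> has_dim H k -> S x ->
  perp S H (projp S H x) /\ H (vsub x (projp S H x)).
Proof.
  intros HS HH Hk Hx. unfold projp. apply epsilon_spec.
  apply has_dim_spec in Hk. destruct Hk as (b & _ & _ & Hb).
  assert (HbS : Forall l2 b).
  { apply Forall_forall. intros v Hv. apply HS, HH, Hb. now apply inspan_in. }
  destruct (orth_proj_exists b x HbS (proj1 HS _ Hx)) as (p & Hp & Ho).
  apply Hb in Hp. exists (vsub x p). repeat split.
  - rewrite vsub_eq. destruct HS as (_ & _ & Ha & Hs). apply Ha; [assumption | ].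
    apply Hs, HH, Hp.
  - intros h Hh. rewrite ip_comm. now apply Ho, Hb.
  - now replace (vsub x (vsub x p)) with p by vec_eq.
Qed.

Lemma subspace_sub (S H : vec -> Prop) (x y : vec) :
  lin_subspace S H -> H x -> H y -> H (vsub x y).
Proof. intros (_ & _ & Ha & Hs) Hx Hy. rewrite vsub_eq. auto. Qed.

(** Fibers are thus the traces on M of the cosets of [H], which reduces statements about projections
    to differences of points. *)
Lemma projp_eq (S H : vec -> Prop) (k : nat) (x y : vec) :
  lin_subspace l2 S -> lin_subspace S H -> has_dim H k -> S x -> S y ->
  (projp S H x = projp S H y <-> H (vsub x y)).
Proof.
  intros HS HH Hk Hx Hy. split.
  - intros Heq. destruct (projp_spec S H k x) as (_ & H1); auto.
    destruct (projp_spec S H k y) as (_ & H2); auto. rewrite Heq in H1.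
    replace (vsub x y) with (vsub (vsub x (projp S H y)) (vsub y (projp S H y))) by vec_eq.
    now apply (subspace_sub S).
  - (* Both sides choose from the same predicate. *)
    intros Hd. unfold projp. f_equal. apply functional_extensionality. intro z.
    apply propositional_extensionality.
    split; intros (H1 & H2); (split; [assumption | ]).
    + replace (vsub y z) with (vsub (vsub x z) (vsub x y)) by vec_eq.
      now apply (subspace_sub S).
    + destruct HH as (_ & _ & Ha & _).
      replace (vsub x z) with (vadd (vsub x y) (vsub y z)) by vec_eq. auto.
Qed.

Lemma star_firstn {T : Type} (n : nat) (l : list (T * T)) : star l -> star (firstn n l).
Proof.
  intros (Hn & Hd). rewrite <- (firstn_skipn n l) in Hn, Hd.
  rewrite map_app in Hn. split.
  - now apply NoDup_app_remove_r in Hn.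
  - intros p q Hp Hq. apply Hd; apply in_app_iff; now left.
Qed.

(** A longer list could be cut to k + 1 pairs, an admissible length, and their independent
    differences would not fit into [H]. *)
Lemma star_length_le_dim (adm : nat -> Prop) (M H : vec -> Prop) (k : nat)
  (l : list (vec * vec)) :
  star_indep adm M -> has_dim H k -> adm (k + 1)%nat ->
  star l -> Forall (pair_in M) l -> (forall p, In p l -> H (vsub (fst p) (snd p))) ->
  (length l <= k)%nat.
Proof.
  intros HM Hk Hadm Hl HlM HlH.
  destruct (Compare_dec.le_lt_dec (length l) k) as [ | Hlt]; [assumption | exfalso].
  apply has_dim_spec in Hk. destruct Hk as (b & Hb & _ & Hspan).
  assert (Hlen : length (firstn (k + 1) l) = (k + 1)%nat) by (apply firstn_length_le; lia).
  assert (Hin : forall p, In p (firstn (k + 1) l) -> In p l).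
  { intros p Hp. rewrite <- (firstn_skipn (k + 1) l). apply in_app_iff. now left. }
  rewrite Forall_forall in HlM.
  assert (Hi : lin_indep (diffs (firstn (k + 1) l))).
  { apply HM; [now rewrite Hlen | now apply star_firstn | ]. apply Forall_forall. auto. }
  assert (Hle : (length (diffs (firstn (k + 1) l)) <= length b)%nat).
  { apply steinitz; [assumption | ]. apply Forall_map, Forall_forall. intros p Hp.
    apply Hspan. auto. }
  unfold diffs in Hle. rewrite length_map, Hlen in Hle. lia.
Qed.

Lemma lincomb_translate (a : vec) (cs : list R) (vs : list vec) :
  length cs = length vs ->
  lincomb cs (map (fun v => vsub v a) vs)
  = vadd (lincomb cs vs) (vscal (- fold_right Rplus 0 cs) a).
Proof.
  revert cs. induction vs as [ | v vs IH]; intros [ | c cs] Hl; try discriminate.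
  - unfold lincomb. simpl. vec_eq.
  - change (vadd (vscal c (vsub v a)) (lincomb cs (map (fun v => vsub v a) vs))
      = vadd (vadd (vscal c v) (lincomb cs vs)) (vscal (- (c + fold_right Rplus 0 cs)) a)).
    rewrite IH by (simpl in Hl; lia). vec_eq.
Qed.

(** For coefficients of sum zero, a combination of the points equals the same combination of their
    differences from [a]. *)
Lemma aff_indep_from_diffs (a : vec) (l : list vec) :
  lin_indep (map (fun v => vsub v a) l) -> aff_indep (a :: l).
Proof.
  intros Hi [ | c cs] Hl Hsum Hc; [discriminate | ].
  assert (Hl' : length cs = length l) by (simpl in Hl; lia). simpl in Hsum.
  change (vadd (vscal c a) (lincomb cs l) = vzero) in Hc.
  assert (Hf : Forall (fun c => c = 0) cs).
  { apply Hi; [now rewrite length_map | ]. rewrite lincomb_translate, <- Hc by assumption.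
    replace c with (- fold_right Rplus 0 cs) by lra. vec_eq. }
  constructor; [ | assumption].
  assert (Hz : fold_right Rplus 0 cs = 0).
  { clear - Hf. induction Hf as [ | x l Hx Hf IH]; simpl; lra. }
  lra.
Qed.

(** Each of the three conditions contains a count. The points counted are arranged in a star list
    with differences in [H], whose length is at most [k] by [star_length_le_dim]. *)
Lemma star_indep_gen_pos (adm : nat -> Prop) (S H M : vec -> Prop) (k : nat) :
  lin_subspace l2 S -> (forall x, M x -> S x) ->
  (forall m m', (m <= m')%nat -> adm m' -> adm m) -> star_indep adm M ->
  lin_subspace S H -> has_dim H k -> adm (k + 1)%nat -> gen_pos S H k M.
Proof.
  intros HS HMS Hdown HM HH Hk Hadm.
  assert (Hproj : forall x y, M x -> M y -> projp S H x = projp S H y -> H (vsub x y)).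
  { intros x y Hx Hy. apply (projp_eq S H k); auto. }
  assert (Hbound := fun l => star_length_le_dim adm M H k l HM Hk Hadm).
  assert (Hfib : forall A r, M A -> NoDup r -> ~ In A r -> Forall (fiber S H M A) r ->
    star (map (fun x => (x, A)) r) /\ Forall (pair_in M) (map (fun x => (x, A)) r) /\
    (length r <= k)%nat).
  { intros A r HA Hn Hin Hr. rewrite Forall_forall in Hr.
    assert (Hst := star_const A r Hn Hin).
    assert (Hp : Forall (pair_in M) (map (fun x => (x, A)) r)).
    { apply Forall_map, Forall_forall. intros x Hx. split; [now apply Hr | assumption]. }
    repeat split; try assumption; [apply Hst | apply Hst | ].
    rewrite <- (length_map (fun x => (x, A))). apply Hbound; [assumption | assumption | ].
    intros p Hp'. apply in_map_iff in Hp'. destruct Hp' as (x & <- & Hx).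
    destruct (Hr x Hx). simpl. auto. }
  split; [ | split].
  - pose (P := fun l => Forall (fun a => M a /\ nondeg S H M a) l /\
      ForallOrdPairs (fun a b => projp S H a <> projp S H b) l).
    destruct (maximal_list P k) as (l & (HlM & Hlo) & Hmax).
    + split; constructor.
    (* Pairing each representative with a second point [g a] of its fiber gives a star list. So
       there are at most [k] non-degenerate fibers, and a maximal list of representatives meets them
       all. *)
    + intros l (HlM & Hlo). rewrite Forall_forall in HlM.
      pose (g := fun a => epsilon (inhabits vzero) (fun B => fiber S H M a B /\ B <> a)).
      assert (Hg : forall a, In a l -> fiber S H M a (g a) /\ g a <> a).
      { intros a Ha. apply epsilon_spec. now apply HlM. }
      assert (Hinj : forall a b, In a l -> In b l -> projp S H a = projp S H b -> a = b).
      { intros a b Ha Hb Heq. destruct (ForallOrdPairs_In Hlo a b Ha Hb) as [ | [Hne | Hne]];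
          [assumption | destruct (Hne Heq) | destruct (Hne (eq_sym Heq))]. }
      assert (Hgp : forall a, In a l -> projp S H (g a) = projp S H a) by (intros; now apply Hg).
      rewrite <- (length_map (fun a => (g a, a))). apply Hbound.
      * split.
        -- rewrite map_map. simpl. apply NoDup_map_NoDup_ForallPairs.
           ++ intros a b Ha Hb Heq. apply Hinj; auto. rewrite <- (Hgp a), <- (Hgp b) by assumption.
              now f_equal.
           ++ clear - Hlo. induction Hlo as [ | a l Ha Hlo IH]; constructor; [ | assumption].
              rewrite Forall_forall in Ha. intros Hin. now apply (Ha a).
        -- intros p q Hp Hq. apply in_map_iff in Hp, Hq.
           destruct Hp as (a & <- & Ha), Hq as (b & <- & Hb). simpl. intros Heq.
           assert (a = b) by (apply Hinj; auto; now rewrite <- Heq, Hgp).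
           subst b. now apply (Hg a Ha).
      * apply Forall_map, Forall_forall. intros a Ha.
        split; simpl; [apply Hg | apply HlM]; assumption.
      * intros p Hp. apply in_map_iff in Hp. destruct Hp as (a & <- & Ha). simpl.
        apply Hproj; [apply Hg | apply HlM | apply Hg]; assumption.
    + exists l. split; [revert HlM; apply Forall_impl; tauto | ].
      intros A HA Hnd. apply NNPP. intros Hno. apply (Hmax A). split.
      * constructor; auto.
      * constructor; [ | assumption]. apply Forall_forall. intros a Ha Heq. apply Hno. eauto.
  - intros A HA _.
    (* A maximal repetition-free list of points of the fiber enumerates it; without [A] it has at
       most [k] entries, hence the bound k + 1. *)
    destruct (maximal_list (fun l => NoDup l /\ Forall (fiber S H M A) l) (k + 1))
      as (l & (Hn & Hl) & Hmax).
    + split; constructor.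
    + intros l (Hn & Hl). assert (Hrem := length_remove_ge A l Hn).
      destruct (Hfib A (remove vec_eq_dec A l)) as (_ & _ & Hle); [assumption | | | | lia].
      * now apply NoDup_remove_all.
      * apply remove_In.
      * rewrite Forall_forall in Hl. apply Forall_forall. intros x Hx. apply in_remove in Hx.
        now apply Hl.
    + exists l. split; [split; [assumption | ] | ].
      * intros x. split.
        -- rewrite Forall_forall in Hl. apply Hl.
        -- intros Hx. apply NNPP. intros Hin. apply (Hmax x). split; constructor; assumption.
      * destruct l as [ | a r].
        { split; [simpl; lia | ]. intros [ | c cs] Hlen _ _; [constructor | discriminate]. }
        (* The head [a] of the enumeration becomes the centre: the differences from it are
           independent by hypothesis. *)
        inversion_clear Hn as [ | ? ? Har Hnr]. inversion_clear Hl as [ | ? ? Ha Hr].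
        destruct Ha as (HMa & Hpa).
        destruct (Hfib a r) as (Hst & Hpair & Hle); auto.
        { revert Hr. apply Forall_impl. intros x (Hx & Hpx). split; [assumption | congruence]. }
        split; [simpl; lia | ]. apply aff_indep_from_diffs.
        replace (map (fun v => vsub v a) r) with (diffs (map (fun x => (x, a)) r))
          by (unfold diffs; now rewrite map_map).
        apply HM; [ | assumption | assumption].
        apply Hdown with (2 := Hadm). rewrite length_map. lia.
  - intros reps Hreps Hord.
    (* All fibers together form one star list, so a single bound covers the whole sum. *)
    apply Nat.le_trans with (length (unfold_stars reps)).
    + apply unfold_stars_length. intros p Hp. now apply Hreps.
    + assert (Hin : forall q, In q (unfold_stars reps) ->
        M (fst q) /\ M (snd q) /\ projp S H (fst q) = projp S H (snd q)).
      { intros q Hq. apply in_unfold_stars in Hq. destruct Hq as (p & Hp & Hs & Hq & _).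
        destruct (Hreps p Hp) as (HMp & _ & He). apply He in Hq. rewrite Hs.
        destruct Hq. auto. }
      apply Hbound.
      * apply (unfold_stars_star (projp S H)); [ | assumption].
        intros p Hp. destruct (Hreps p Hp) as (_ & Hn & He). split; [assumption | ].
        intros a Ha. apply He, Ha.
      * apply Forall_forall. intros q Hq. split; now apply Hin.
      * intros q Hq. apply Hproj; now apply Hin.
Qed.

(** If the differences were dependent, their span H would have dimension less than the length of the
    list. Each leaf lies in the fiber of its centre, so the sum over these fibers is at least that
    length and exceeds dim H. *)
Lemma gen_pos_star_indep (adm : nat -> Prop) (S M : vec -> Prop) :
  lin_subspace l2 S -> (forall x, M x -> S x) ->
  (forall m m', (m <= m')%nat -> adm m' -> adm m) ->
  (forall H k, lin_subspace S H -> nonzero_sub H -> has_dim H k -> adm (k + 1)%nat ->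
     gen_pos S H k M) ->
  star_indep adm M.
Proof.
  intros HS HMS Hdown Hgp l Hadm (Hn & Hd) HlM. apply NNPP. intros Hdep.
  destruct (extract_basis (diffs l)) as (b & Hi & Hincl & Hspan & Hlt).
  specialize (Hlt Hdep). unfold diffs in Hlt at 1. rewrite length_map in Hlt.
  assert (Hin : forall p, In p l -> inspan b (vsub (fst p) (snd p))).
  { intros p Hp. apply Hspan. exact (in_map (fun p => vsub (fst p) (snd p)) _ _ Hp). }
  rewrite Forall_forall in HlM.
  assert (HbS : Forall S b).
  { apply Forall_forall. intros v Hv. apply Hincl, in_map_iff in Hv.
    destruct Hv as (p & <- & Hp). destruct (HlM p Hp). apply (subspace_sub l2); auto. }
  assert (HH : lin_subspace S (inspan b)).
  { repeat split; auto using inspan_zero, inspan_add, inspan_scal.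
    intros x. now apply inspan_closed. }
  assert (Hk : has_dim (inspan b) (length b)) by (exists b; repeat split; auto).
  destruct (Hgp (inspan b) (length b) HH) as (_ & Hfib & Hsum); [ | assumption | | ].
  (* The list is longer than a basis, hence non-empty, and a leaf differs from its own centre; so
     the span is non-zero. *)
  - destruct l as [ | p l]; [simpl in Hlt; lia | ].
    exists (vsub (fst p) (snd p)). split; [apply Hin; now left | ].
    intros H0. apply (Hd p p); [now left | now left | ].
    apply functional_extensionality. intro i.
    assert (H := f_equal (fun f => f i) H0). unfold vsub, vzero in H. lra.
  - apply Hdown with (2 := Hadm). lia.
  - set (H := inspan b) in *.
    (* The sum condition takes fibers as lists. Non-degenerate ones are enumerated by the second
       condition, and a degenerate one is a singleton. *)
    assert (Hen : forall A, M A -> exists e, enumerates (fiber S H M A) e).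
    { intros A HA. destruct (classic (nondeg S H M A)) as [Hnd | Hnd].
      - destruct (Hfib A HA Hnd) as (e & He & _). eauto.
      - exists [A]. split; [constructor; [auto | constructor] | ].
        intros x. split.
        + intros Hx. destruct Hx as [<- | Hx]; [split; auto | destruct Hx].
        + intros Hx. left. apply NNPP. intros Hne. apply Hnd. exists x. auto. }
    pose (en := fun A => epsilon (inhabits []) (enumerates (fiber S H M A))).
    assert (Hen' : forall A, M A -> enumerates (fiber S H M A) (en A)).
    { intros A HA. apply epsilon_spec. auto. }
    (* Several centres may share a fiber, so one is kept per fiber. A leaf lies in the fiber of the
       kept centre and differs from it by the star condition. *)
    destruct (select_representatives (projp S H) (map snd l)) as (r & Hr & Hro & Hrc).
    assert (HrM : forall B, In B r -> M B /\ exists p, In p l /\ snd p = B).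
    { intros B HB. apply Hr, in_map_iff in HB. destruct HB as (p & <- & Hp).
      split; [now apply HlM | eauto]. }
    assert (Hle := Hsum (map (fun B => (B, en B)) r)).
    assert (Hge : (length (map fst l) <= length b)%nat); [ | rewrite length_map in Hge; lia].
    eapply Nat.le_trans; [ | apply Hle].
    + apply fibers_cover_length; [ | assumption | ].
      * intros p Hp. apply in_map_iff in Hp. destruct Hp as (B & <- & HB).
        destruct (HrM B HB) as (HMB & _). apply Hen'; [assumption | ]. split; auto.
      * intros a Ha. apply in_map_iff in Ha. destruct Ha as (p & <- & Hp).
        destruct (Hrc (snd p)) as (B & HB & Heq); [now apply in_map | ].
        destruct (HrM B HB) as (HMB & q & Hq & <-). destruct (HlM p Hp).
        exists (snd q, en (snd q)). repeat split.
        -- apply in_map_iff. eauto.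
        -- apply Hen'; [assumption | ]. split; [assumption | ]. rewrite <- Heq.
           apply (projp_eq S H (length b)); auto.
        -- simpl. auto.
    + intros p Hp. apply in_map_iff in Hp. destruct Hp as (B & <- & HB).
      destruct (HrM B HB) as (HMB & _). auto.
    + now apply ForallOrdPairs_map.
Qed.

(** * Density *)

(** Besides linearity, this is what the density argument uses about [S]: room to move a leaf out of
    the span of the other differences. *)
Definition escapes_spans (S : vec -> Prop) (adm : nat -> Prop) : Prop :=
  forall m vs, adm m -> (length vs < m)%nat -> exists u, S u /\ ~ inspan vs u.

Definition pick_pairs {T : Type} (p : nat -> T) (pat : list (nat * nat)) : list (T * T) :=
  map (fun ij => (p (fst ij), p (snd ij))) pat.

(** Induction on the pattern: after the tail has been made independent, only the leaf of the first
    pair is moved, which leaves the tail unchanged. *)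
Lemma star_perturb (S : vec -> Prop) (adm : nat -> Prop) (p : nat -> vec)
  (pat : list (nat * nat)) (e : R) :
  lin_subspace l2 S -> (forall m m', (m <= m')%nat -> adm m' -> adm m) ->
  escapes_spans S adm -> star pat -> adm (length pat) -> (forall i, S (p i)) -> 0 < e ->
  exists p', (forall i, S (p' i) /\ vdist (p i) (p' i) < e) /\
    lin_indep (diffs (pick_pairs p' pat)).
Proof.
  intros HS Hdown Hesc. revert e. induction pat as [ | (i, j) pat IH]; intros e Hst Hadm Hp He.
  - exists p. split; [ | apply lin_indep_nil]. intro i. rewrite vdist_refl. auto.
  - destruct Hst as (Hn & Hd). simpl in Hn. apply NoDup_cons_iff in Hn. destruct Hn as (Hi & Hn).
    destruct (IH (e / 2)) as (q & Hq & Hind).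
    + split; [assumption | ]. intros a b Ha Hb. apply Hd; now right.
    + apply Hdown with (2 := Hadm). simpl. lia.
    + assumption.
    + lra.
    + set (ds := diffs (pick_pairs q pat)) in *.
      (* A difference outside the span needs no move. One inside leaves the span when t u is added,
         with [u] outside it and [t] nonzero. *)
      destruct (classic (inspan ds (vsub (q i) (q j)))) as [Hin | Hin].
      2: { exists q. split.
           - intro k. destruct (Hq k). split; [assumption | lra].
           - simpl. apply lin_indep_cons. auto. }
      destruct (Hesc (length ((i, j) :: pat)) ds) as (u & Hu & Hnu); [assumption | | ].
      { unfold ds, diffs, pick_pairs. rewrite !length_map. simpl. lia. }
      assert (Lu : l2 u) by now apply HS.
      assert (Nu := vnorm_nonneg u).
      (* Chosen so that t |u| < e/2, the other half being spent by the induction hypothesis; the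
         summand 1 avoids a division by zero. *)
      set (t := e / 2 / (vnorm u + 1)).
      assert (Ht : 0 < t) by (apply Rdiv_lt_0_compat; lra).
      assert (Htu : t * vnorm u < e / 2).
      { replace (e / 2) with (t * (vnorm u + 1)) by (unfold t; field; lra). lra. }
      pose (p' := fun k => if Nat.eq_dec k i then vadd (q i) (vscal t u) else q k).
      assert (Hne : forall k, k <> i -> p' k = q k).
      { intros k Hk. unfold p'. now destruct (Nat.eq_dec k i). }
      assert (Heq : p' i = vadd (q i) (vscal t u)).
      { unfold p'. now destruct (Nat.eq_dec i i). }
      assert (Hs : S (vadd (q i) (vscal t u))).
      { destruct HS as (_ & _ & Ha & Hs). apply Ha; [apply Hq | now apply Hs]. }
      exists p'. split.
      * intro k. destruct (Hq k) as (Hk & Hdk). destruct (Nat.eq_dec k i) as [-> | Hki].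
        -- rewrite Heq. split; [assumption | ].
           assert (Hdt : vdist (q i) (vadd (q i) (vscal t u)) = t * vnorm u).
           { unfold vdist.
             replace (vsub (q i) (vadd (q i) (vscal t u))) with (vscal (- t) u) by vec_eq.
             rewrite vnorm_scal, Rabs_Ropp, Rabs_pos_eq by (assumption || lra). reflexivity. }
           generalize (vdist_triangle (p i) (q i) _ (proj1 HS _ (Hp i)) (proj1 HS _ Hk)
             (proj1 HS _ Hs)). lra.
        -- rewrite Hne by assumption. split; [assumption | lra].
      (* By the star condition [i] occurs in no other pair and differs from [j], so the first
         difference changes by t u and all others stay fixed. *)
      * replace (diffs (pick_pairs p' ((i, j) :: pat)))
          with (vsub (vadd (q i) (vscal t u)) (q j) :: ds).
        -- apply lin_indep_cons. split; [assumption | ]. intros Hin'. apply Hnu.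
           replace u with (vscal (/ t)
             (vsub (vsub (vadd (q i) (vscal t u)) (q j)) (vsub (q i) (q j))))
             by (vec_eq; field; lra).
           now apply inspan_scal, inspan_sub.
        -- unfold ds, diffs, pick_pairs. rewrite !map_map. simpl. f_equal.
           ++ rewrite Heq, Hne; [reflexivity | ]. intros Hji.
              now apply (Hd (i, j) (i, j) (or_introl eq_refl) (or_introl eq_refl)).
           ++ apply map_ext_in. intros ab Hab.
              rewrite !Hne; [reflexivity | | ].
              ** intros Hbi. apply (Hd (i, j) ab); [now left | now right | now symmetry].
              ** intros Hai. apply Hi. rewrite <- Hai. now apply in_map.
Qed.

Lemma diffs_indep_open (S : vec -> Prop) (xs : list (vec * vec)) :
  lin_subspace l2 S -> Forall (pair_in S) xs -> lin_indep (diffs xs) ->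
  exists e, 0 < e /\ forall ys, Forall2 (near_pair S e) xs ys -> lin_indep (diffs ys).
Proof.
  intros HS Hxs Hi.
  assert (Hl2 : Forall l2 (diffs xs)).
  { apply Forall_map. revert Hxs. apply Forall_impl. intros p (H1 & H2).
    apply l2_sub; now apply HS. }
  destruct (lin_indep_open _ Hl2 Hi) as (e & He & H).
  exists (e / 2). split; [lra | ]. intros ys Hys. apply H. clear - HS Hxs Hys.
  induction Hys as [ | (a, b) (c, d) xs ys (H1 & H2 & H3 & H4) Hys IH]; simpl; constructor.
  - inversion_clear Hxs as [ | ? ? (Ha & Hb) _]. simpl in *.
    apply (proj1 HS) in Ha, Hb, H1, H2. split; [now apply l2_sub | ].
    unfold vdist in *.
    replace (vsub (vsub a b) (vsub c d)) with (vadd (vsub a c) (vscal (-1) (vsub b d))) by vec_eq.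
    assert (Hac := l2_sub _ _ Ha H1). assert (Hbd := l2_sub _ _ Hb H2).
    assert (Ht := vnorm_triangle _ _ Hac (l2_scal (-1) _ Hbd)).
    rewrite vnorm_scal, Rabs_m1 in Ht by assumption. lra.
  - apply IH. now inversion_clear Hxs.
Qed.

(** The patterns are treated one at a time. The move for a new one stays below a radius [d] within
    which all patterns already treated remain independent. *)
Lemma star_perturb_list (S : vec -> Prop) (adm : nat -> Prop) (p : nat -> vec)
  (pats : list (list (nat * nat))) (e : R) :
  lin_subspace l2 S -> (forall m m', (m <= m')%nat -> adm m' -> adm m) ->
  escapes_spans S adm -> (forall i, S (p i)) -> 0 < e ->
  exists p', (forall i, S (p' i) /\ vdist (p i) (p' i) < e) /\
    forall pat, In pat pats -> star pat -> adm (length pat) ->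
      lin_indep (diffs (pick_pairs p' pat)).
Proof.
  intros HS Hdown Hesc Hp. revert e. induction pats as [ | pat pats IH]; intros e He.
  - exists p. split; [ | intros pat Hpat; destruct Hpat].
    intro i. rewrite vdist_refl. auto.
  - destruct (IH (e / 2)) as (q & Hq & Hind); [lra | ].
    destruct (uniform_radius pats (fun pat d => star pat -> adm (length pat) ->
      forall p', (forall i, S (p' i) /\ vdist (q i) (p' i) < d) ->
        lin_indep (diffs (pick_pairs p' pat)))) as (d & Hd & Hstable).
    + intros c d d' H Hd Hst Hadm p' Hp'. apply H; auto. intro i. destruct (Hp' i).
      split; [assumption | lra].
    + intros c Hc. destruct (classic (star c /\ adm (length c))) as [(Hst & Hadm) | Hno].
      2: { exists 1. split; [lra | ]. intros. tauto. }
      destruct (diffs_indep_open S (pick_pairs q c) HS) as (d & Hd & Hopen); auto.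
      * apply Forall_map, Forall_forall. intros ij _. split; apply Hq.
      * exists d. split; [assumption | ]. intros _ _ p' Hp'. apply Hopen.
        clear - Hp'. induction c as [ | ij c IH]; simpl; constructor; [ | assumption].
        repeat split; apply Hp'.
    + destruct (classic (star pat /\ adm (length pat))) as [(Hst & Hadm) | Hno].
      * assert (Hm : 0 < Rmin (e / 2) d) by (apply Rmin_glb_lt; lra).
        destruct (star_perturb S adm q pat (Rmin (e / 2) d)) as (p' & Hp' & Hpat); auto.
        { intro i. apply Hq. }
        assert (H1 := Rmin_l (e / 2) d). assert (H2 := Rmin_r (e / 2) d).
        exists p'. split.
        -- intro i. destruct (Hp' i) as (Hi & Hdi), (Hq i) as (Hqi & Hdq). split; [assumption | ].
           generalize (vdist_triangle _ _ _ (proj1 HS _ (Hp i)) (proj1 HS _ Hqi) (proj1 HS _ Hi)).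
           lra.
        -- intros c [<- | Hc] Hcs Hca; [assumption | ]. apply (Hstable c Hc Hcs Hca).
           intro i. destruct (Hp' i). split; [assumption | lra].
      * exists q. split.
        -- intro i. destruct (Hq i). split; [assumption | lra].
        -- intros c [<- | Hc] Hcs Hca; [tauto | auto].
Qed.

Lemma bounded_lists {T : Type} (al : list T) (n : nat) :
  exists ls, forall l, incl l al -> (length l <= n)%nat -> In l ls.
Proof.
  induction n as [ | n (ls & IH)].
  - exists [[]]. intros [ | x l] _ Hl; [now left | simpl in Hl; lia].
  - exists ([] :: flat_map (fun x => map (cons x) ls) al).
    intros [ | x l] Hi Hl; [now left | right]. apply in_flat_map. exists x.
    apply incl_cons_inv in Hi. destruct Hi. split; [assumption | ]. apply in_map.
    apply IH; [assumption | simpl in Hl; lia].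
Qed.

(** The points [p i] may coincide, so [f] picks one index for each point. This turns a star list
    into a star pattern, of length at most [n] since its leaves are distinct. *)
Lemma star_indep_finite (adm : nat -> Prop) (p : nat -> vec) (n : nat) :
  (forall pat, incl pat (list_prod (seq 0 n) (seq 0 n)) -> (length pat <= n)%nat ->
     star pat -> adm (length pat) -> lin_indep (diffs (pick_pairs p pat))) ->
  star_indep adm (fun x => In x (map p (seq 0 n))).
Proof.
  intros H l Hadm (Hn & Hd) HlM. rewrite Forall_forall in HlM.
  pose (f := fun x => epsilon (inhabits 0%nat) (fun i => In i (seq 0 n) /\ p i = x)).
  assert (Hf : forall x, In x (map p (seq 0 n)) -> In (f x) (seq 0 n) /\ p (f x) = x).
  { intros x Hx. apply epsilon_spec. apply in_map_iff in Hx. destruct Hx as (i & Hi & Hin). eauto. }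
  pose (pat := map (fun q => (f (fst q), f (snd q))) l).
  assert (Hpat : pick_pairs p pat = l).
  { unfold pick_pairs, pat. rewrite map_map. rewrite <- map_id. apply map_ext_in.
    intros (a, b) Hab. destruct (HlM _ Hab) as (Ha & Hb). simpl in *.
    now rewrite (proj2 (Hf a Ha)), (proj2 (Hf b Hb)). }
  rewrite <- Hpat. apply H.
  - intros ij Hij. apply in_map_iff in Hij. destruct Hij as (q & <- & Hq).
    destruct (HlM q Hq). apply in_prod; now apply Hf.
  - unfold pat. rewrite length_map, <- (length_map fst).
    rewrite <- (length_seq n 0), <- (length_map p). apply NoDup_incl_length; [assumption | ].
    intros a Ha. apply in_map_iff in Ha. destruct Ha as (q & <- & Hq). now apply HlM.
  - split.
    + unfold pat. rewrite map_map. simpl. rewrite <- (map_map fst f).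
      apply NoDup_map_NoDup_ForallPairs; [ | assumption].
      intros a b Ha Hb Heq. apply in_map_iff in Ha, Hb.
      destruct Ha as (q & <- & Hq), Hb as (r & <- & Hr).
      destruct (HlM q Hq) as (Hq1 & _), (HlM r Hr) as (Hr1 & _).
      rewrite <- (proj2 (Hf _ Hq1)), <- (proj2 (Hf _ Hr1)). now f_equal.
    + intros ij kl Hij Hkl. apply in_map_iff in Hij, Hkl.
      destruct Hij as (q & <- & Hq), Hkl as (r & <- & Hr). simpl. intros Heq.
      destruct (HlM q Hq) as (Hq1 & _), (HlM r Hr) as (_ & Hr1).
      apply (Hd q r Hq Hr).
      rewrite <- (proj2 (Hf _ Hq1)), <- (proj2 (Hf _ Hr1)). now f_equal.
  - unfold pat. now rewrite length_map.
Qed.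

Lemma star_indep_dense (S : vec -> Prop) (adm : nat -> Prop) :
  lin_subspace l2 S -> (forall m m', (m <= m')%nat -> adm m' -> adm m) ->
  escapes_spans S adm -> K_dense S (fun M => Kset S M /\ star_indep adm M).
Proof.
  intros HS Hdown Hesc M (HM & (x0 & Hx0)) e He.
  assert (HMS := proj1 HM). assert (HSl2 := proj1 HS).
  destruct (finite_net S M (e / 4) HSl2 HM) as (l & Hl & Hnet); [lra | ].
  rewrite Forall_forall in Hl.
  (* The default [x0] lies in [M], so every [p i] does, also beyond the length of the net. *)
  set (p := fun i => nth i l x0).
  assert (Hp : forall i, M (p i)).
  { intro i. unfold p. destruct (Compare_dec.le_lt_dec (length l) i) as [Hi | Hi].
    - now rewrite nth_overflow.
    - apply Hl. now apply nth_In. }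
  set (n := length l).
  destruct (bounded_lists (list_prod (seq 0 n) (seq 0 n)) n) as (pats & Hpats).
  destruct (star_perturb_list S adm p pats (e / 4)) as (q & Hq & Hind); auto; [lra | ].
  pose (M' := fun x => In x (map q (seq 0 n))).
  assert (HK : Kset S M').
  { apply finite_Kset.
    - destruct (Hnet x0 Hx0) as (y & Hy & _). unfold n. destruct l; [destruct Hy | discriminate].
    - apply Forall_map, Forall_forall. intros i _. apply Hq. }
  exists M'. repeat split; try apply HK.
  - apply star_indep_finite. auto.
  (* The net and the perturbation contribute e/4 each. *)
  - assert (Hex : hdist M M' <= e / 2); [ | lra].
    apply Rmax_lub; apply excess_le.
    + eauto.
    + intros x Hx. destruct (Hnet x Hx) as (y & Hy & Hd).
      destruct (In_nth _ _ x0 Hy) as (i & Hi & Hiy). fold (p i) in Hiy. subst y.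
      exists (q i). split.
      * apply in_map, in_seq. unfold n. lia.
      * rewrite vdist_sym in Hd. destruct (Hq i) as (Hqi & Hdi).
        generalize (vdist_triangle x (p i) (q i) (HSl2 _ (HMS _ Hx)) (HSl2 _ (HMS _ (Hp i)))
          (HSl2 _ Hqi)). lra.
    + apply HK.
    + intros a Ha. apply in_map_iff in Ha. destruct Ha as (i & <- & _).
      exists (p i). split; [apply Hp | ]. rewrite vdist_sym. destruct (Hq i). lra.
Qed.

(** * The G_delta property *)

Definition pair0 : vec * vec := (vzero, vzero).

(** A quantitative form of [star] given by non-strict inequalities, so that its failure is an open
    condition. The second inequality includes i = j. *)
Definition separated (d : R) (l : list (vec * vec)) : Prop :=
  forall i j, (i < length l)%nat -> (j < length l)%nat ->
    (i <> j -> d <= vdist (fst (nth i l pair0)) (fst (nth j l pair0))) /\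
    d <= vdist (fst (nth i l pair0)) (snd (nth j l pair0)).

Lemma separated_star (d : R) (l : list (vec * vec)) : 0 < d -> separated d l -> star l.
Proof.
  intros Hd Hs. split.
  - apply (NoDup_nth _ (fst pair0)). rewrite length_map. intros i j Hi Hj Heq.
    destruct (Nat.eq_dec i j) as [ | Hn]; [assumption | exfalso].
    rewrite !map_nth in Heq. apply (Hs i j Hi Hj) in Hn. rewrite Heq, vdist_refl in Hn. lra.
  - intros p q Hp Hq Heq.
    destruct (In_nth _ _ pair0 Hp) as (i & Hi & <-), (In_nth _ _ pair0 Hq) as (j & Hj & <-).
    destruct (Hs i j Hi Hj) as (_ & H). rewrite Heq, vdist_refl in H. lra.
Qed.

Lemma star_separated (l : list (vec * vec)) : star l -> Forall (pair_in l2) l ->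
  exists d, 0 < d /\ separated d l.
Proof.
  intros (Hn & Hd) Hl. rewrite Forall_forall in Hl.
  destruct (uniform_radius (list_prod (seq 0 (length l)) (seq 0 (length l)))
    (fun ij d => (fst ij <> snd ij ->
        d <= vdist (fst (nth (fst ij) l pair0)) (fst (nth (snd ij) l pair0))) /\
      d <= vdist (fst (nth (fst ij) l pair0)) (snd (nth (snd ij) l pair0)))) as (d & Hd0 & H).
  - intros (i, j) d d' (H1 & H2) Hd'. simpl in *. split; [ | lra].
    intros Hij. specialize (H1 Hij). lra.
  - intros (i, j) Hij. apply in_prod_iff in Hij. rewrite !in_seq in Hij. simpl.
    assert (Hi := nth_In l pair0 (n := i)). assert (Hj := nth_In l pair0 (n := j)).
    destruct Hij as ((_ & Hi') & (_ & Hj')). specialize (Hi Hi'). specialize (Hj Hj').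
    destruct (Hl _ Hi) as (Li & _), (Hl _ Hj) as (Lj & Lj').
    assert (H2 := vdist_pos _ _ Li Lj' (Hd _ _ Hi Hj)).
    destruct (Nat.eq_dec i j) as [-> | Hij].
    + eexists. split; [exact H2 | ]. split; [congruence | lra].
    + assert (H1 : 0 < vdist (fst (nth i l pair0)) (fst (nth j l pair0))).
      { apply vdist_pos; auto. intros Heq. apply Hij.
        apply (proj1 (NoDup_nth (map fst l) (fst pair0)) Hn);
          rewrite ?length_map, ?map_nth; auto. }
      eexists. split; [exact (Rmin_glb_lt _ _ _ H1 H2) | ].
      split; [intros _; apply Rmin_l | apply Rmin_r].
  - exists d. split; [assumption | ]. intros i j Hi Hj. apply (H (i, j)).
    apply in_prod; apply in_seq; lia.
Qed.

Lemma separated_near (S : vec -> Prop) (d e : R) (xs ys : list (vec * vec)) :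
  (forall y, S y -> l2 y) -> Forall (pair_in S) xs -> Forall2 (near_pair S e) xs ys ->
  separated d ys -> separated (d - 2 * e) xs.
Proof.
  intros HS Hxs Hnear Hsep i j Hi Hj.
  assert (Hlen := Forall2_length Hnear).
  assert (Hnth : forall k, (k < length xs)%nat -> near_pair S e (nth k xs pair0) (nth k ys pair0)).
  { clear - Hnear. induction Hnear as [ | p q xs ys Hpq Hnear IH]; simpl; [lia | ].
    intros [ | k] Hk; [assumption | apply IH; lia]. }
  rewrite Forall_forall in Hxs.
  destruct (Hxs _ (nth_In xs pair0 Hi)) as (Si & _).
  destruct (Hxs _ (nth_In xs pair0 Hj)) as (Sj & Sj').
  destruct (Hnth i Hi) as (Ti & _ & Di & _), (Hnth j Hj) as (Tj & Tj' & Dj & Dj').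
  destruct (Hsep i j) as (H1 & H2); try lia.
  assert (Htri : forall a b c f, S a -> S b -> S c -> S f ->
    vdist c f <= vdist a c + vdist a b + vdist b f).
  { intros a b c f Ha Hb Hc Hf.
    generalize (vdist_triangle c a f (HS _ Hc) (HS _ Ha) (HS _ Hf))
      (vdist_triangle a b f (HS _ Ha) (HS _ Hb) (HS _ Hf)).
    rewrite (vdist_sym c a). lra. }
  split.
  - intros Hij. specialize (H1 Hij). generalize (Htri _ _ _ _ Si Sj Ti Tj). lra.
  - generalize (Htri _ _ _ _ Si Sj' Ti Tj'). lra.
Qed.

(** If lists arbitrarily near [xs] were separated by [d], then [xs] would be separated by d - 2 e
    for every e > 0, hence by [d]. *)
Lemma separated_closed (S : vec -> Prop) (d : R) (xs : list (vec * vec)) :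
  (forall y, S y -> l2 y) -> Forall (pair_in S) xs -> ~ separated d xs ->
  exists e, 0 < e /\ forall ys, Forall2 (near_pair S e) xs ys -> ~ separated d ys.
Proof.
  intros HS Hxs Hnot. apply NNPP. intros Hno. apply Hnot.
  assert (H : forall e, 0 < e -> separated (d - 2 * e) xs).
  { intros e He. apply NNPP. intros Hn. apply Hno. exists e. split; [assumption | ].
    intros ys Hys Hsep. apply Hn. now apply separated_near with S ys. }
  intros i j Hi Hj.
  assert (Hlim : forall r, (forall e, 0 < e -> d - 2 * e <= r) -> d <= r).
  { intros r Hr. apply Rnot_lt_le. intros Hlt. specialize (Hr ((d - r) / 4)). lra. }
  split; [intros Hij | ]; apply Hlim; intros e He; now apply (H e He i j Hi Hj).
Qed.

Lemma nearby_pairs (S M M' : vec -> Prop) (e : R) (ys : list (vec * vec)) :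
  (forall y, M' y -> S y) -> (forall y, M' y -> exists x, M x /\ vdist y x < e) ->
  Forall (pair_in M') ys ->
  exists xs, Forall (pair_in M) xs /\ Forall2 (near_pair S e) xs ys.
Proof.
  intros HM' Hnear Hys. induction Hys as [ | (c, d) ys (Hc & Hd) Hys (xs & Hxs & H2)].
  - exists []. split; constructor.
  - simpl in *. destruct (Hnear c Hc) as (a & Ha & Hac), (Hnear d Hd) as (b & Hb & Hbd).
    exists ((a, b) :: xs). split; constructor; auto.
    + split; assumption.
    + rewrite vdist_sym in Hac, Hbd. repeat split; simpl; auto.
Qed.

(** Around a separated list independence persists; around one that is not separated, nearby lists
    are not separated either. Compactness gives one radius for all lists in [M], and every list in a
    nearby M' is close to one of these. *)
Lemma separated_indep_open (S : vec -> Prop) (m : nat) (d : R) : lin_subspace l2 S ->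
  K_open S (fun M => Kset S M /\ forall l, length l = m -> separated d l ->
    Forall (pair_in M) l -> lin_indep (diffs l)).
Proof.
  intros HS. assert (HSl2 := proj1 HS). split; [tauto | ]. intros M (HK & HM).
  destruct (tube_lemma S M m (fun ys _ => separated d ys -> lin_indep (diffs ys)))
    as (e & He & H); auto.
  - apply HK.
  - intros xs Hlen Hxs.
    assert (HxS : Forall (pair_in S) xs).
    { revert Hxs. apply Forall_impl. intros p (H1 & H2). split; now apply (proj1 HK). }
    destruct (classic (separated d xs)) as [Hsep | Hsep].
    + destruct (diffs_indep_open S xs HS HxS (HM xs Hlen Hsep Hxs)) as (e & He & H).
      exists e. auto.
    + destruct (separated_closed S d xs HSl2 HxS Hsep) as (e & He & H).
      exists e. split; [assumption | ]. intros ys Hys Hy. now apply H in Hys.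
  - exists e. split; [assumption | ]. intros M' HK' Hd. split; [assumption | ].
    intros ys Hlen Hsep Hys.
    destruct (nearby_pairs S M M' e ys) as (xs & Hxs & Hxy); auto.
    + apply HK'.
    + apply (excess_lt S M' M); auto. apply Rle_lt_trans with (2 := Hd). apply Rmax_r.
    + apply (H xs ys); auto. now rewrite (Forall2_length Hxy).
Qed.

Lemma star_indep_Gdelta (S : vec -> Prop) (adm : nat -> Prop) : lin_subspace l2 S ->
  K_Gdelta S (fun M => Kset S M /\ star_indep adm M).
Proof.
  (* The index n encodes a length and a number j, the latter standing for the separation 1/(j+1). *)
  intros HS. pose (deg := fun n => fst (Cantor.of_nat n)).
  pose (gap := fun n => / INR (Datatypes.S (snd (Cantor.of_nat n)))).
  assert (Hgap : forall n, 0 < gap n).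
  { intro n. apply Rinv_0_lt_compat, lt_0_INR. lia. }
  exists (fun n M => Kset S M /\ forall l, length l = deg n -> separated (gap n) l ->
    Forall (pair_in M) l -> adm (deg n) -> lin_indep (diffs l)).
  split.
  - intro n. destruct (classic (adm (deg n))) as [Ha | Ha].
    + destruct (separated_indep_open S (deg n) (gap n) HS) as (_ & H). split; [tauto | ].
      intros M (HK & HM). destruct (H M) as (e & He & Hb).
      * auto.
      * exists e. split; [assumption | ]. intros M' HK' Hd.
        destruct (Hb M' HK' Hd). auto.
    (* A length that is not admissible imposes nothing: the set is all of K(S), and any radius will
       do. *)
    + split; [tauto | ]. intros M _. exists 1. split; [lra | ]. intros. split; [assumption | tauto].
  - intros M. split.
    + intros (HK & HM) n. split; [assumption | ]. intros l Hlen Hsep Hl Ha.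
      apply HM; [now rewrite Hlen | now apply separated_star with (gap n) | assumption].
    + intros H. split; [apply (H 0%nat) | ]. intros l Ha Hst Hl.
      destruct (H 0%nat) as (HK & _).
      destruct (star_separated l Hst) as (d & Hd & Hsep).
      { revert Hl. apply Forall_impl. intros p (H1 & H2).
        split; now apply (proj1 HS), (proj1 (proj1 HK)). }
      (* Some 1/(j+1) lies below [d], so the list is covered by the condition with the code of its
         length and j. *)
      destruct (archimed_cor1 d Hd) as ([ | j] & Hj & Hj0); [lia | ].
      destruct (H (Cantor.to_nat (length l, j))) as (_ & Hn).
      unfold deg, gap in Hn. rewrite Cantor.cancel_of_to in Hn. simpl fst in Hn. simpl snd in Hn.
      apply Hn; auto. intros a b Hai Hbi. destruct (Hsep a b Hai Hbi) as (H1 & H2).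
      split; [intros Hab; specialize (H1 Hab); lra | lra].
Qed.

(** * Application to R^N and l_2 *)

Lemma star_indep_dense_Gdelta (S : vec -> Prop) (adm : nat -> Prop)
  (gp : (vec -> Prop) -> Prop) :
  lin_subspace l2 S -> (forall m m', (m <= m')%nat -> adm m' -> adm m) ->
  escapes_spans S adm -> (forall M, Kset S M -> (gp M <-> star_indep adm M)) ->
  K_dense_Gdelta S (fun M => Kset S M /\ gp M).
Proof.
  intros HS Hdown Hesc Hgp. split; [tauto | split].
  - intros M HM e He.
    destruct (star_indep_dense S adm HS Hdown Hesc M HM e He) as (M' & HK & (_ & Hst) & Hd).
    exists M'. repeat split; try apply HK; [ | assumption]. now apply Hgp.
  - destruct (star_indep_Gdelta S adm HS) as (U & HU & Heq). exists U. split; [assumption | ].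
    intros M. rewrite <- Heq. split; intros (HK & H); (split; [assumption | ]); now apply Hgp.
Qed.

Theorem theorem1 :
  (forall N : nat, (2 <= N)%nat ->
     K_dense_Gdelta (RN N) (fun M => Kset (RN N) M /\ gp_all_proj (RN N) M)) /\
  K_dense_Gdelta l2 (fun M => Kset l2 M /\ gp_fd_proj l2 M).
Proof.
  split.
  - intros N _.
    assert (Hesc : escapes_spans (RN N) (fun m => (m <= N)%nat)).
    { intros m vs Hm Hl. apply RN_escape_span. lia. }
    apply star_indep_dense_Gdelta with (fun m => (m <= N)%nat).
    + apply RN_subspace.
    + intros; lia.
    + assumption.
    + intros M HK. assert (HMS := proj1 (proj1 HK)). split.
      * intros Hgp. apply (gen_pos_star_indep _ (RN N)); auto using RN_subspace.
        -- intros; lia.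
        (* Admissibility of k + 1 means k < N, so a basis of H does not span R^N and H is proper. *)
        -- intros H k HH Hne Hk Hadm. apply Hgp; auto.
           apply has_dim_spec in Hk. destruct Hk as (b & Hb & _ & Hs).
           destruct (Hesc _ b Hadm) as (u & Hu & Hn); [lia | ].
           exists u. split; [assumption | ]. now rewrite Hs.
      * intros Hst H k HH Hne (u & Hu & Hn) Hk.
        apply (star_indep_gen_pos (fun m => (m <= N)%nat)); auto using RN_subspace.
        -- intros; lia.
        (* A vector outside the proper subspace H extends its basis to k + 1 independent vectors of
           R^N, so k + 1 <= N. *)
        -- apply has_dim_spec in Hk. destruct Hk as (b & Hb & Hi & Hs).
           assert (Hle : (length (u :: b) <= N)%nat); [ | simpl in Hle; lia].
           apply RN_indep_length.
           ++ constructor; [assumption | ]. apply Forall_forall. intros v Hv.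
              apply HH, Hs. now apply inspan_in.
           ++ apply lin_indep_cons. split; [assumption | ]. now rewrite <- Hs.
  - apply star_indep_dense_Gdelta with (fun _ => True); auto using l2_subspace.
    + intros m vs _ _.
      (* The copy of R^m in l_2 with m one more than the length of [vs] already escapes the span. *)
      destruct (RN_escape_span (Datatypes.S (length vs)) vs) as (u & Hu & Hn); [lia | ].
      exists u. split; [now apply RN_l2 in Hu | assumption].
    + intros M HK. assert (HMS := proj1 (proj1 HK)). split.
      * intros Hgp. apply (gen_pos_star_indep _ l2); auto using l2_subspace.
      * intros Hst H k HH Hne Hk.
        apply (star_indep_gen_pos (fun _ => True)); auto using l2_subspace.
Qed.
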